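(* For every $q\geqslant 1$ there exist $\tilde{p}<1$ and $\kappa>0$ such that for every $p\geqslant\tilde{p}$, every $c\geqslant 1$ and every box $\Lambda$ with $|\Lambda|\geqslant\max\{3^{6d},(cd)^{cd^2}\}$, $$\mu_{\Lambda,p,q}\Big(\exists e\in\mathcal{P}\cup\mathcal{I},\ d\big(e,\Lambda^c\cup\mathcal{P}\setminus\{e\}\big)\geqslant \kappa c^2\ln^2|\Lambda|\Big)\leqslant\frac{1}{|\Lambda|^c}.$$
   Context: Let $d\geqslant 2$ and $\mathbb{L}^d=(\mathbb{Z}^d,\mathbb{E}^d)$ the nearest-neighbour lattice. The box $\Lambda=(V,E)$ is the subgraph of $\mathbb{L}^d$ induced by the vertices in a $d$-dimensional cube centred at the origin (not necessarily axis-parallel); $|\Lambda|$ is its cardinality (number of edges), $\Lambda^c$ its complement, $d(\cdot,\cdot)$ the lattice distance between edges/sets of edges. $\partial\Lambda=\{x\in V:\exists y\notin V,\ \langle x,y\rangle\in\mathbb{E}^d\}$. A hyperplane through the origin parallel to a face of the cube splits $\Lambda$ into $\Lambda^+,\Lambda^-$; $T=\partial\Lambda\cap\Lambda^+$, $B=\partial\Lambda\cap\Lambda^-$. FK measure with Dobrushin boundary condition: for $\omega\in\{0,1\}^E$ (edges with $\omega(e)=1$ open, others closed), $\Phi^{TB}_{\Lambda,p,q}(\omega)\propto\prod_{e\in E}p^{\omega(e)}(1-p)^{1-\omega(e)}q^{k^{TB}(\omega)}$, where $k^{TB}(\omega)$ is the number of connected components (isolated vertices included) of the graph obtained from $(V,\{\text{open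 edges}\})$ by adding two extra vertices, one joined to every vertex of $T$, the other to every vertex of $B$. $\{T\nleftrightarrow B\}$: no open path in $\Lambda$ joins $T$ to $B$. Coupled dynamics: $(E_t)_{t\in\mathbb{N}}$ i.i.d. uniform on $E$ and $(U_t)_{t\in\mathbb{N}}$ i.i.d. uniform on $[0,1]$, independent. With $\Phi=\Phi^{TB}_{\Lambda,p,q}$, $\omega^e$ (resp. $\omega_e$) the configuration $\omega$ with $e$ opened (resp. closed), and $\theta(\omega,e)=\Phi(\omega_e)/(\Phi(\omega^e)+\Phi(\omega_e))$: at time $t$, with $e=E_t$, only edge $e$ is updated; $X_t(e)=1$ if $U_t\geqslant\theta(X_{t-1},e)$ and $0$ otherwise; $Y_t(e)=1$ if $U_t\geqslant\theta(Y_{t-1},e)$ and $T$ is not connected to $B$ in $(Y_{t-1})^e$, and $0$ otherwise. On the state space $\{(\omega_1,\omega_2):\omega_2\in\{T\nleftrightarrow B\},\ \omega_1\geqslant\omega_2\text{ edgewise}\}$ the chain $(X_t,Y_t)$ has a unique stationary distribution $\mu_{\Lambda,p,q}$. For a pair $(X,Y)$ distributed according to $\mu_{\Lambda,p,q}$: the interface is $\mathcal{I}=\{e\in E: X(e)\neq Y(e)\}$, and $\mathcal{P}$ is the set of pivotal edges of $Y$, i.e. edges $e\in E$ such that $T$ is connected to $B$ by an open path in $Y^e$. *)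

(* Defs.v *)
From HB Require Import structures.
From mathcomp Require Import all_boot all_order all_algebra.
From mathcomp Require Import all_classical all_reals all_analysis.
Set Implicit Arguments. Unset Strict Implicit. Unset Printing Implicit Defensive.
Import Order.TTheory GRing.Theory Num.Theory.
Local Open Scope ring_scope.

Definition zpt (d : nat) := {ffun 'I_d -> int}.
Definition zmove d (x : zpt d) (i : 'I_d) (z : int) : zpt d :=
  [ffun k => x k + (if k == i then z else 0)].
(* an edge of L^d is encoded uniquely as (x, i), standing for {x, x + e_i} *)
Definition zedge (d : nat) := (zpt d * 'I_d)%type.
Definition zend2 d (f : zedge d) : zpt d := zmove f.1 f.2 1.
Definition l1dist d (x y : zpt d) : nat := (\sum_(k < d) `|x k - y k|)%N.
Definition edist d (e f : zedge d) : nat :=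
  minn (minn (l1dist e.1 f.1) (l1dist e.1 (zend2 f)))
       (minn (l1dist (zend2 e) f.1) (l1dist (zend2 e) (zend2 f))).

Definition coordU (R : realType) d (U : 'M[R]_d) (i : 'I_d) (x : zpt d) : R :=
  \sum_(k < d) U i k * (x k)%:~R.
(* closed cube centred at origin, orthonormal frame U (rows), half-side L *)
Definition in_cube (R : realType) d (U : 'M[R]_d) (L : R) (x : zpt d) : bool :=
  [forall i, `|coordU U i x| <= L].
Definition is_box (R : realType) d (U : 'M[R]_d) (L : R) (s : seq (zpt d)) : Prop :=
  [/\ U *m U^T = 1%:M, 0 < L & forall x, (x \in s) = in_cube U L x].

Definition Vt d (s : seq (zpt d)) := seq_sub s.
Definition Epred d (s : seq (zpt d)) (e : Vt s * 'I_d) : bool :=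
  zmove (val e.1) e.2 1 \in s.
Definition Et d (s : seq (zpt d)) := {e : Vt s * 'I_d | Epred e}.
Definition emb d (s : seq (zpt d)) (e : Et s) : zedge d := (val (val e).1, (val e).2).
(* membership of an edge of L^d in E (its complement is Lambda^c) *)
Definition inE d (s : seq (zpt d)) (f : zedge d) : bool := (f.1 \in s) && (zend2 f \in s).

Definition cfg d (s : seq (zpt d)) := {ffun Et s -> bool}.
Definition upd d (s : seq (zpt d)) (w : cfg s) (e : Et s) (b : bool) : cfg s :=
  [ffun f => if f == e then b else w f].

Definition openrel d (s : seq (zpt d)) (w : cfg s) : rel (Vt s) :=
  fun v v' => [exists e : Et s, w e &&
     (((emb e).1 == val v) && (zend2 (emb e) == val v') ||
      ((emb e).1 == val v') && (zend2 (emb e) == val v))].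

Definition bdry d (s : seq (zpt d)) (v : Vt s) : bool :=
  [exists i : 'I_d, (zmove (val v) i 1 \notin s) || (zmove (val v) i (-1) \notin s)].
Definition plus_side (R : realType) d (s : seq (zpt d)) (U : 'M[R]_d) (j : 'I_d)
  (v : Vt s) : bool := 0 <= coordU U j (val v).
Definition Tset (R : realType) d (s : seq (zpt d)) (U : 'M[R]_d) (j : 'I_d) (v : Vt s) :=
  bdry v && plus_side U j v.
Definition Bset (R : realType) d (s : seq (zpt d)) (U : 'M[R]_d) (j : 'I_d) (v : Vt s) :=
  bdry v && ~~ plus_side U j v.

Definition TBconn (R : realType) d (s : seq (zpt d)) (U : 'M[R]_d) (j : 'I_d) (w : cfg s) :=
  [exists v, exists v', [&& Tset U j v, Bset U j v' & connect (openrel w) v v']].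

Definition augrel (R : realType) d (s : seq (zpt d)) (U : 'M[R]_d) (j : 'I_d) (w : cfg s)
  : rel (Vt s + bool) :=
  fun a b => match a, b with
  | inl v, inl v' => openrel w v v'
  | inl v, inr true | inr true, inl v => Tset U j v
  | inl v, inr false | inr false, inl v => Bset U j v
  | _, _ => false
  end.
Definition kTB (R : realType) d (s : seq (zpt d)) (U : 'M[R]_d) (j : 'I_d) (w : cfg s) : nat :=
  #|(fun a => [set b | connect (augrel U j w) a b]) @: [set: Vt s + bool]|.

Definition FKweight (R : realType) d (s : seq (zpt d)) (U : 'M[R]_d) (j : 'I_d) (p q : R)
  (w : cfg s) : R :=
  (\prod_(e : Et s) (if w e then p else 1 - p)) * q ^+ kTB U j w.
Definition PhiTB (R : realType) d (s : seq (zpt d)) (U : 'M[R]_d) (j : 'I_d) (p q : R)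
  (w : cfg s) : R :=
  FKweight U j p q w / \sum_(w' : cfg s) FKweight U j p q w'.
Definition theta (R : realType) d (s : seq (zpt d)) (U : 'M[R]_d) (j : 'I_d) (p q : R)
  (w : cfg s) (e : Et s) : R :=
  PhiTB U j p q (upd w e false) /
  (PhiTB U j p q (upd w e true) + PhiTB U j p q (upd w e false)).

Definition step (R : realType) d (s : seq (zpt d)) (U : 'M[R]_d) (j : 'I_d) (p q : R)
  (st : cfg s * cfg s) (e : Et s) (u : R) : cfg s * cfg s :=
  (upd st.1 e (theta U j p q st.1 e <= u),
   upd st.2 e ((theta U j p q st.2 e <= u) && ~~ TBconn U j (upd st.2 e true))).

Definition kernel (R : realType) d (s : seq (zpt d)) (U : 'M[R]_d) (j : 'I_d) (p q : R)
  (st st' : cfg s * cfg s) : R :=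
  (#|{: Et s}|%:R)^-1 * \sum_(e : Et s)
     fine (lebesgue_measure [set u : R | (0 <= u <= 1) /\ step U j p q st e u = st']).

Definition state_space (R : realType) d (s : seq (zpt d)) (U : 'M[R]_d) (j : 'I_d)
  (st : cfg s * cfg s) : bool :=
  ~~ TBconn U j st.2 && [forall e, st.2 e ==> st.1 e].

Definition stationary (R : realType) d (s : seq (zpt d)) (U : 'M[R]_d) (j : 'I_d) (p q : R)
  (mu : cfg s * cfg s -> R) : Prop :=
  [/\ forall st, 0 <= mu st,
      \sum_st mu st = 1,
      forall st, ~~ state_space U j st -> mu st = 0 &
      forall st', mu st' = \sum_st mu st * kernel U j p q st st'].

Definition pivotal (R : realType) d (s : seq (zpt d)) (U : 'M[R]_d) (j : 'I_d)
  (w : cfg s) (e : Et s) : bool := TBconn U j (upd w e true).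

Definition bad_event (R : realType) d (s : seq (zpt d)) (U : 'M[R]_d) (j : 'I_d) (r : R)
  (st : cfg s * cfg s) : Prop :=
  exists e : Et s,
    [/\ pivotal U j st.2 e || (st.1 e != st.2 e),
        forall f : zedge d, ~~ inE s f -> r <= (edist (emb e) f)%:R &
        forall f : Et s, pivotal U j st.2 f -> f != e -> r <= (edist (emb e) (emb f))%:R].

Definition prob (R : realType) d (s : seq (zpt d)) (mu : cfg s * cfg s -> R)
  (A : cfg s * cfg s -> Prop) : R :=
  \sum_(st | `[< A st >]) mu st.

(* Main.v *)
(* Write [N] for the number of edges. For [p < 1] the chain Y is reversible and its
   stationary law is the FK measure conditioned on disconnection; opening a set of
   closed edges that keeps T and B disconnected multiplies its weight by at least
   [eps^-1] per edge. Call a box calm if the T-cluster and the B-cluster do not both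
   meet it: it then contains no pivotal edge, and any set of its edges can be opened.

   If a box is not calm, the boundary of the T-cluster contains a long walk of
   closed edges across a larger box (a Z/2-cohomology argument). If [e] is the only
   pivotal edge around, this walk can be opened except for [e]: a Peierls estimate
   excludes it. Within [N] steps a fixed set [F] of edges becomes closed in a calm
   box with probability at most [(2 eps)^|F|], since closing a non-pivotal edge costs
   [eps]; so a box of radius [r] cannot stop being calm at depth [O(ln N)] in that
   time, and by reversibility a box of radius [O(ln^2 N)] which is calm now has been
   calm, at depth [O(ln^2 N)], during the last [O(N ln N)] steps. During that time
   a discrepancy [X(f) <> Y(f)] can only be created if the endpoints of [f] are
   connected in X and not in Y, hence from an older discrepancy to which [f] is
   joined by closed edges of Y. The probability that a set [F] is closed and carries
   a discrepancy thus decays exponentially in time, like [(1 - 1 / (2 N))^k].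

   For [p = 1] every closed edge of Y is almost surely pivotal. *)
Require Import Defs.
From HB Require Import structures.
From mathcomp Require Import all_boot all_order all_algebra.
From mathcomp Require Import all_classical all_reals all_analysis.
From mathcomp Require Import zify lra ring.
Import Order.TTheory GRing.Theory Num.Theory.
Local Open Scope ring_scope.
Set Implicit Arguments. Unset Strict Implicit. Unset Printing Implicit Defensive.

(** * The lattice and its Z/2-cochains *)

Section Lattice.
Variable d : nat.
Implicit Types (x y ctr : zpt d) (i j : 'I_d).

(** The obstacle is that only the marginal law of Y is explicit, and that pivotal edges of Y are
    closed at no cost. All estimates are therefore made for Y alone, in boxes free of pivotal edges;
    X enters only through the one-step rule that creates a discrepancy. A discrepancy is correlated
    with the closed edges around it, so the event that [F] is closed and carries a discrepancy is
    bounded for all [F] at once, by induction in time, against a weight [lam ^ #|F|]. Here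
    [lam = 1 / (8 * Delta)], where [Delta = d * 3 ^ d] bounds the number of neighbours of an edge,
    and [eps = q * (1 - p) / p] is at most [lam / 8]; this last condition fixes how close to 1 the
    density must be. The squared logarithm arises as follows: with [n] of order [c * ln N],
    discrepancies need [2 * n] blocks of [N] steps to shrink by [2 ^ - n], and each block costs
    [n + 2] units of radius to the calm box. For [p = 1] the weight of any configuration with a
    closed edge vanishes, so reversibility gives nothing and stationarity is used directly. *)

Definition inbox (ctr : zpt d) (R : nat) x : bool :=
  [forall k, (absz (x k - ctr k) <= R)%N].

Lemma zmoveE x i z k : zmove x i z k = x k + (if k == i then z else 0).
Proof. by rewrite ffunE. Qed.

Lemma zmoveC x i j a b : zmove (zmove x i a) j b = zmove (zmove x j b) i a.
Proof. by apply/ffunP => k; rewrite !zmoveE; case: (k == i); case: (k == j); lia. Qed.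

Lemma zmoveD x i a b : zmove (zmove x i a) i b = zmove x i (a + b).
Proof. by apply/ffunP => k; rewrite !zmoveE; case: (k == i); lia. Qed.

Lemma zmove0 x i : zmove x i 0 = x.
Proof. by apply/ffunP => k; rewrite !zmoveE if_same addr0. Qed.

Lemma inboxP ctr R x :
  reflect (forall k, (absz (x k - ctr k) <= R)%N) (inbox ctr R x).
Proof. exact: forallP. Qed.

Lemma inbox_trans ctr R R' x y :
  inbox ctr R x -> inbox x R' y -> inbox ctr (R + R') y.
Proof.
move=> /inboxP Hx /inboxP Hy; apply/inboxP => k.
by move: (Hx k) (Hy k); lia.
Qed.

Lemma inbox_le ctr R R' x : (R <= R')%N -> inbox ctr R x -> inbox ctr R' x.
Proof. by move=> le /inboxP Hx; apply/inboxP => k; apply: leq_trans (Hx k) le. Qed.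

Lemma inbox_refl R x : inbox x R x.
Proof. by apply/inboxP => k; rewrite subrr. Qed.

Lemma inbox_sym R x y : inbox x R y = inbox y R x.
Proof. by apply/inboxP/inboxP => H k; move: (H k); lia. Qed.

Lemma inbox_zmove x i : inbox x 1 (zmove x i 1).
Proof. by apply/inboxP => k; rewrite zmoveE; case: (k == i); lia. Qed.

Lemma inbox_zmoveN x i : inbox x 1 (zmove x i (-1)).
Proof. by apply/inboxP => k; rewrite zmoveE; case: (k == i); lia. Qed.

Lemma inbox_zmove2 x i j : inbox (zmove x i 1) 1 (zmove x j 1).
Proof. by apply/inboxP => k; rewrite !zmoveE; case: (k == i); case: (k == j); lia. Qed.

(* A compactly supported Z/2-cocycle is the coboundary of the sum of its values
   along the ray in direction [- e_i0]; the ray of a point above the support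
   is moved out of its shadow along [e_i1], which needs [d >= 2]. *)
Lemma poincare (ctr : zpt d) (R : nat) (c : zpt d -> 'I_d -> bool) (i0 i1 : 'I_d) :
  i0 != i1 ->
  (forall x i j, c x i (+) c (zmove x i 1) j (+) c (zmove x j 1) i (+) c x j = false) ->
  (forall x i, c x i -> inbox ctr R x) ->
  exists h : zpt d -> bool,
    (forall x i, h (zmove x i 1) = h x (+) c x i) /\
    (forall x, ~~ inbox ctr R.+1 x -> h x = false).
Proof.
move=> i01 plaq supp.
pose H n x := \big[addb/false]_(k < n) c (zmove x i0 (- (k.+1)%:Z)) i0.
pose M x := (absz (x i0 - ctr i0) + R + 1)%N.
have off n x i : (M x <= n)%N -> c (zmove x i0 (- n%:Z)) i = false.
  move=> le; apply/negP => /supp /inboxP /(_ i0).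
  by rewrite zmoveE eqxx; move: le; rewrite /M; lia.
have stab n x : (M x <= n)%N -> H n x = H (M x) x.
  move=> le; rewrite -(subnKC le); elim: (n - M x)%N => [|k IH]; first by rewrite addn0.
  by rewrite addnS /H big_ord_recr /= off ?addbF //; lia.
have tele n x i : H n (zmove x i 1) = H n x (+) (c x i (+) c (zmove x i0 (- n%:Z)) i).
  elim: n => [|n IH]; first by rewrite /H !big_ord0 /= oppr0 zmove0 addbb.
  rewrite /H !big_ord_recr /= -!/(H _ _) IH.
  have := plaq (zmove x i0 (- n.+1%:Z)) i0 i.
  rewrite zmoveD (_ : - n.+1%:Z + 1 = - n%:Z); last by lia.
  rewrite (zmoveC x i).
  by case: (c _ _); case: (c _ _); case: (c _ _); case: (c _ _); case: (c _ _); case: (H _ _).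
exists (fun x => H (M x) x); split.
  move=> x i; pose n := (M x + M (zmove x i 1))%N.
  by rewrite -(stab n) ?leq_addl // tele off ?leq_addr // addbF (stab n) ?leq_addr.
have H0 n x : (exists2 k, k != i0 & (R < absz (x k - ctr k))%N) -> H n x = false.
  move=> [k ki0 big]; rewrite /H big1 // => m _.
  apply/negP => /supp /inboxP /(_ k); rewrite zmoveE (negbTE ki0); lia.
move=> x /forallPn [k]; rewrite -ltnNge => big.
case: (eqVneq k i0) => [E|ki0]; last by apply: H0; exists k => //; lia.
subst k; case: (lerP (x i0) (ctr i0)) => [le|gt].
  rewrite /H big1 // => m _; apply/negP => /supp /inboxP /(_ i0).
  rewrite zmoveE eqxx; lia.
pose n := M x.
have nx m : H n (zmove x i1 m%:Z) = H n x.
  elim: m => [|m IH]; first by rewrite zmove0.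
  rewrite (_ : m.+1%:Z = m%:Z + 1); last by lia.
  rewrite -zmoveD tele IH.
  have -> : c (zmove x i1 m) i1 = false.
    apply/negP => /supp /inboxP /(_ i0).
    rewrite zmoveE (negbTE i01); lia.
  rewrite off ?addbF // /M zmoveE (negbTE i01) addr0 //.
rewrite -(nx (absz (x i1 - ctr i1) + R + 1)%N) H0 //.
exists i1; first by rewrite eq_sym.
rewrite zmoveE eqxx; lia.
Qed.

Lemma l1dist_inbox (R : nat) x y : inbox x R y -> (l1dist x y <= d * R)%N.
Proof.
move=> /inboxP H; rewrite /l1dist -[d in (_ <= d * R)%N]card_ord -sum_nat_const.
apply: leq_sum => k _; move: (H k); lia.
Qed.

Lemma edist_inbox (R : nat) (e f : zedge d) :
  inbox e.1 R f.1 -> (Defs.edist e f <= d * R)%N.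
Proof.
by move=> /l1dist_inbox le; rewrite /Defs.edist; apply: leq_trans le; rewrite !geq_min leqnn.
Qed.

(** Descent on the l1 distance to [ctr]: moving a differing coordinate one unit towards [ctr] never
    leaves the box. *)
Lemma inbox_walk (ctr : zpt d) (R : nat) (h : zpt d -> bool) :
  (forall x i, inbox ctr R x -> inbox ctr R (zmove x i 1) -> h (zmove x i 1) = h x) ->
  forall x, inbox ctr R x -> h x = h ctr.
Proof.
move=> hstep x.
have [n] := ubnP (\sum_k absz (x k - ctr k))%N; elim: n x => // n IH x lt bx.
case: (boolP [exists k, x k != ctr k]) => [/existsP [k kne]|]; last first.
  rewrite negb_exists => /forallP E; congr h; apply/ffunP => k.
  by have := E k; rewrite negbK => /eqP.
pose s : int := if x k < ctr k then 1 else -1.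
have dec y : y = zmove x k s -> (\sum_k absz (y k - ctr k) < n)%N /\ inbox ctr R y.
  move=> ->; split.
    apply: leq_trans (_ : \sum_k absz (x k - ctr k) <= n)%N; last by lia.
    rewrite (bigD1 k) //= [X in (_ < X)%N](bigD1 k) //=.
    rewrite (eq_bigr (fun k => absz (x k - ctr k))); last first.
      by move=> l /negbTE ne; rewrite zmoveE ne addr0.
    by rewrite ltn_add2r zmoveE eqxx /s; move: kne; case: ltP; lia.
  apply/inboxP => l; rewrite zmoveE; move/inboxP: bx => /(_ l).
  by case: eqP => [->|_]; rewrite ?addr0 // /s; move: kne; case: ltP; lia.
have [lt' by'] := dec _ erefl.
rewrite -(IH _ lt' by') /s; move: by'; rewrite /s; case: ltP => _ by'.
  by rewrite hstep.
rewrite -[in LHS](zmove0 x k) -(_ : -1 + 1 = 0) // -zmoveD hstep // zmoveD.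
by rewrite addNr zmove0.
Qed.

End Lattice.

(** * Walks of edges and cut sets *)

Section Walks.
Variables (T : finType) (r : rel T).

(** A list for each length and start, so that union bounds over walks become sums with at most
    [k ^ n] terms. The start itself is not listed. *)
Fixpoint walks (n : nat) (x : T) : seq (seq T) :=
  if n is m.+1 then flatten [seq [seq y :: p | p <- walks m y] | y <- enum (r x)]
  else [:: [::]].

Lemma walksP n x p : reflect (size p = n /\ path r x p) (p \in walks n x).
Proof.
elim: n x p => [|n IH] x p.
  rewrite inE; apply: (iffP eqP) => [->|[/size0nil]] //.
apply: (iffP flatten_mapP) => [[y]|[]].
  by rewrite mem_enum => rxy /mapP [q /IH [<- pq] ->] /=; split=> //; apply/andP.
case: p => // y p [sz] /= /andP [rxy pp]; exists y; first by rewrite mem_enum.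
by apply/mapP; exists p => //; apply/IH.
Qed.

Lemma size_walks k : (forall x, (#|r x| <= k)%N) ->
  forall n x, (size (walks n x) <= k ^ n)%N.
Proof.
move=> deg; elim=> [|n IH] x //=.
rewrite size_flatten /shape -map_comp expnS.
apply: (@leq_trans (#|r x| * k ^ n)); last by rewrite leq_mul2r deg orbT.
rewrite sumnE big_map cardE -sum1_size big_distrl /=.
by apply: leq_sum => y _; rewrite size_map mul1n IH.
Qed.

Lemma connect_uniq_path (S : pred T) x y :
  connect (fun a b => r a b && S b) x y ->
  exists p, [/\ path r x p, uniq (x :: p), all S p & last x p = y].
Proof.
move=> /connectP [p0 pp0 ->]; case/shortenP: pp0 => p pp up _.
exists p; split=> //; move: x pp {up p0}; elim: p => //= z p IH x.
  by move=> /andP [/andP [-> _]] /IH.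
by move=> /andP [/andP [_ ->]] /IH.
Qed.

End Walks.

Section Box.
Variables (d : nat) (s : seq (zpt d)).
Implicit Types (f g : Et s) (p : seq (Et s)).

Definition base g : zpt d := (emb g).1.

Lemma emb_inj : injective (@emb d s).
Proof.
move=> [[x i] px] [[y j] py] [exy eij]; apply: val_inj => /=.
by rewrite eij; congr (_, _); apply: val_inj.
Qed.

Lemma embP x i : x \in s -> zmove x i 1 \in s -> exists g, emb g = (x, i).
Proof.
move=> xs ys; pose v : Vt s := SeqSub xs.
by exists (exist (@Epred d s) (v, i) ys).
Qed.

(** Any two edges of a unit square have base points within sup-distance 1. This coarse adjacency is
    all that the cut-set argument needs, and its degree is easy to bound. *)
Definition eadj : rel (Et s) := fun f g => inbox (base f) 1 (base g).

Lemma eadj_deg f : (#|eadj f| <= d * 3 ^ d)%N.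
Proof.
pose code g : {ffun 'I_d -> 'I_3} * 'I_d :=
  ([ffun k => inord (absz (base g k - base f k + 1))], (emb g).2).
have inj : {in eadj f &, injective code}.
  move=> g h /inboxP ag /inboxP ah [/ffunP ek ed].
  apply: emb_inj; congr (_, _); last exact: ed.
  apply/ffunP => k; have := ek k; rewrite !ffunE => /(congr1 val) /=.
  have [bg bh] : (absz (base g k - base f k + 1)%R < 3 /\ absz (base h k - base f k + 1)%R < 3)%N.
    by move: (ag k) (ah k); lia.
  rewrite !inordK // => E; change (base g k = base h k).
  by move: E (ag k) (ah k); lia.
rewrite -(card_in_imset inj) (leq_trans (max_card _)) //.
by rewrite card_prod card_ffun !card_ord mulnC.
Qed.

Lemma path_inbox f p : path eadj f p -> inbox (base f) (size p) (base (last f p)).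
Proof.
elim: p f => [|g p IH] f /=; first by rewrite inbox_refl.
by move=> /andP [fg /IH]; rewrite -add1n; apply: inbox_trans.
Qed.

Definition cutting (A : zpt d -> bool) g : bool := A (base g) (+) A (zend2 (emb g)).

(* The alternative comes from [poincare]: if no walk in the cut set leaves the
   box, then every unit square meets the closure [D] of [S0] in an even number
   of edges, because a square meeting [D] has all its cut edges in [D]. *)
Lemma cut_dichotomy (ctr : zpt d) (R : nat) (A : zpt d -> bool) (S0 : pred (Et s))
    (i0 i1 : 'I_d) :
  i0 != i1 ->
  (forall x, inbox ctr R.+2 x -> x \in s) ->
  let S g := cutting A g && inbox ctr R.+1 (base g) in
  (forall g, S0 g -> S g) ->
  (exists f p, [/\ S0 f, path eadj f p, uniq (f :: p), all S p
                 & ~~ inbox ctr R (base (last f p))]) \/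
  exists (h : zpt d -> bool) (D : pred (Et s)),
    [/\ forall g, S0 g -> D g,
        forall g, D g -> exists f p,
          [/\ S0 f, path eadj f p, uniq (f :: p), all S p & last f p = g],
        forall x i, h (zmove x i 1) = h x (+) [exists g, D g && (emb g == (x, i))]
      & forall x, ~~ inbox ctr R.+1 x -> h x = false].
Proof.
move=> i01 boxs S S0S.
pose r a b := eadj a b && S b.
pose D g := [exists f, S0 f && connect r f g].
have DP g : D g -> exists f p,
    [/\ S0 f, path eadj f p, uniq (f :: p), all S p & last f p = g].
  move=> /existsP [f /andP [S0f /connect_uniq_path [p [pp up Sp lp]]]].
  by exists f, p.
case: (boolP [exists g, D g && ~~ inbox ctr R (base g)]) => [/existsP [g /andP [Dg out]]|].
  by left; have [f [p [S0f pp up Sp lp]]] := DP g Dg; exists f, p; split; rewrite ?lp.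
rewrite negb_exists => /forallP inR; right.
have {}inR g : D g -> inbox ctr R (base g).
  by move=> Dg; have := inR g; rewrite Dg negbK.
have DS g : D g -> S g.
  move=> /DP [f [p [S0f _ _ Sp <-]]]; elim/last_ind: p Sp => [|p q _] /=; first by rewrite S0S.
  by rewrite all_rcons last_rcons => /andP [].
have Dadj f g : D f -> eadj f g -> S g -> D g.
  move=> /existsP [f0 /andP [S0f cf]] fg Sg; apply/existsP; exists f0; rewrite S0f.
  by apply: connect_trans cf (connect1 _); rewrite /r fg Sg.
pose c x i := [exists g, D g && (emb g == (x, i))].
have cS x i : c x i -> inbox ctr R x.
  by move=> /existsP [g /andP [/inR]] + /eqP E; rewrite /base E.
(* [D] stays in radius [R], so the edges of a square meeting it start in radius [R.+1] and end in
   radius [R.+2], inside [s]; on these edges [c] is the coboundary of [A]. *)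
have cE f x i : D f -> inbox (base f) 1 x ->
    c x i = A x (+) A (zmove x i 1).
  move=> Df fx; have bx : inbox ctr R.+1 x by rewrite -addn1; apply: inbox_trans fx; apply: inR.
  have [||g Eg] := @embP x i.
  - by apply: boxs; apply: inbox_le bx.
  - by apply: boxs; rewrite -addn1; apply: inbox_trans bx (inbox_zmove _ _).
  have -> : c x i = D g.
    apply/existsP/idP => [[g' /andP [Dg' /eqP]]|Dg]; last by exists g; rewrite Dg Eg eqxx.
    by rewrite -Eg => /emb_inj <-.
  have -> : A x (+) A (zmove x i 1) = S g.
    by rewrite /S /cutting /base /zend2 Eg /= bx andbT.
  by apply/idP/idP => [/DS //|Sg]; apply: Dadj Df _ Sg; rewrite /eadj {2}/base Eg.
have plaq x i j :
    c x i (+) c (zmove x i 1) j (+) c (zmove x j 1) i (+) c x j = false.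
  case: (boolP [exists g, D g && [|| emb g == (x, i), emb g == (zmove x i 1, j),
      emb g == (zmove x j 1, i) | emb g == (x, j)]]) => [/existsP [g /andP [Dg eg]]|].
    have [b1 b2 b3] : [/\ inbox (base g) 1 x, inbox (base g) 1 (zmove x i 1)
        & inbox (base g) 1 (zmove x j 1)].
      case/or4P: eg => /eqP E; rewrite /base E /=; split;
      by rewrite ?inbox_refl ?inbox_zmove ?inbox_zmove2 // inbox_sym inbox_zmove.
    rewrite !(cE g) // (zmoveC x j).
    by case: (A _); case: (A _); case: (A _); case: (A _).
  rewrite negb_exists => /forallP no.
  have c0 y k : (forall g, emb g == (y, k) -> ~~ D g) -> c y k = false.
    by move=> H; apply/existsP => -[g /andP [Dg /H]]; rewrite Dg.
  by rewrite !c0 // => g E; have := no g; rewrite E ?orbT andbT.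
have [h [hc h0]] := poincare i01 plaq cS.
exists h, D; split=> //.
by move=> g S0g; apply/existsP; exists g; rewrite S0g connect0.
Qed.

End Box.

(** * Connections in the augmented graph *)

Section Classes.
Variable V : finType.

Definition nclasses (e : rel V) : nat := #|(fun a => [set b | connect e a b]) @: [set: V]|.

Variables (e e' : rel V) (a b : V).
Hypotheses (esym : symmetric e)
  (e'E : forall x y, e' x y = [|| e x y, (x == a) && (y == b) | (x == b) && (y == a)]).

Let csym : connect_sym e := sym_connect_sym esym.
Let cls x := [set y | connect e x y].
Let cls' x := [set y | connect e' x y].

Let sub x y : connect e x y -> connect e' x y.
Proof. by apply: connect_sub => u v euv; apply: connect1; rewrite e'E euv. Qed.

Let cab : connect e' a b. Proof. by apply: connect1; rewrite e'E !eqxx orbT. Qed.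
Let cba : connect e' b a. Proof. by apply: connect1; rewrite e'E !eqxx !orbT. Qed.

Lemma connect_add_edge : connect e a b -> connect e' =2 connect e.
Proof.
move=> ab x y; apply/idP/idP; last exact: sub.
apply: connect_sub => u v; rewrite e'E => /or3P [/connect1 //|/andP[/eqP -> /eqP ->] //|].
by move=> /andP[/eqP -> /eqP ->]; rewrite csym.
Qed.

Let clsP x y : connect e x y -> cls x = cls y.
Proof. by move=> xy; apply/setP => z; rewrite !inE; exact: (same_connect csym). Qed.

Lemma cls_add_edge x : cls' x = if connect e x a || connect e x b then cls a :|: cls b else cls x.
Proof.
(* A step of [e'] that is not in [e] goes from one of [a], [b] to the other: it can only be taken
   from the merged class, and stays in it. *)
have key u v : connect e' u v ->
   v \in (if connect e u a || connect e u b then cls a :|: cls b else cls u).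
  move=> /connectP [p pp ->]; elim/last_ind: p pp => [|p z IH] /=.
    move=> _; case: ifP => [|_]; rewrite !inE ?connect0 //.
    by rewrite csym [connect e u b]csym.
  rewrite rcons_path last_rcons => /andP [/IH {}IH st].
  move: st IH; set t := last u p; rewrite e'E => /or3P [tz||].
  - case: ifP => _; rewrite !inE; last by move=> H; apply: connect_trans H (connect1 tz).
    by move=> /orP [] H; apply/orP; [left|right]; apply: connect_trans H (connect1 tz).
  - move=> /andP [/eqP -> /eqP ->]; case: ifP => [_ _|/norP [+ _]]; rewrite !inE ?connect0 ?orbT //.
    by move=> /negbTE ->.
  - move=> /andP [/eqP -> /eqP ->]; case: ifP => [_ _|/norP [_]]; rewrite !inE ?connect0 ?orbT //.
    by move=> /negbTE ->.
apply/setP => y; rewrite inE; apply/idP/idP => [/key //|].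
case: ifP => [xab|_]; rewrite !inE; last exact: sub.
have xa : connect e' x a.
  by case/orP: xab => [/sub //|/sub xb]; apply: connect_trans xb cba.
by move=> /orP [] /sub; apply: connect_trans => //; apply: connect_trans xa cab.
Qed.

(** The classes of [a] and [b] are replaced by their union; [J] collects the classes left
    untouched. *)
Lemma nclasses_add_edge : ~~ connect e a b -> nclasses e = (nclasses e').+1.
Proof.
move=> nab.
have mem x y : (cls x == cls y) = connect e x y.
  apply/eqP/idP => [/setP /(_ y)|/clsP //]; by rewrite !inE connect0.
pose I := cls @: [set: V]; pose I' := cls' @: [set: V].
rewrite /nclasses -/I -/I'.
have aI : cls a \in I by apply: imset_f.
have bI : cls b \in I by apply: imset_f.
have ab : cls a != cls b by rewrite mem.
pose J := I :\ cls a :\ cls b.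
have -> : I' = (cls a :|: cls b) |: J.
  apply/setP => C; apply/imsetP/idP => [[x _ ->]|].
    rewrite cls_add_edge; case: ifP => [_|/norP [xa xb]]; first by rewrite setU11.
    by rewrite !inE !mem xa xb imset_f ?orbT.
  rewrite !inE => /orP [/eqP ->|/and3P [Cb Ca /imsetP [x _ E]]].
    by exists a => //; rewrite cls_add_edge connect0.
  exists x => //; rewrite cls_add_edge -!mem -E (negbTE Ca) (negbTE Cb) //.
have nJ : cls a :|: cls b \notin J.
  apply/negP; rewrite !inE => /and3P [_ ne /imsetP [x _ E]].
  have : a \in cls x by rewrite -E !inE connect0.
  by rewrite inE => /clsP xa; rewrite E xa eqxx in ne.
have bI' : cls b \in I :\ cls a by rewrite !inE eq_sym ab bI.
by rewrite cardsU1 nJ (cardsD1 (cls a) I) aI (cardsD1 (cls b)) bI'.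
Qed.

End Classes.

(** * Clusters of T and B, calm boxes, and walks of closed edges *)

Section Aug.
Variables (R : realType) (d : nat) (s : seq (zpt d)) (U : 'M[R]_d) (j : 'I_d).
Implicit Types (w : cfg s) (f g e : Et s) (v : Vt s) (ctr : zpt d).

Definition end1 g : Vt s := (val g).1.
Definition end2 g : Vt s := SeqSub (valP g).

Lemma val_end1 g : val (end1 g) = base g. Proof. by []. Qed.
Lemma val_end2 g : val (end2 g) = zend2 (emb g). Proof. by []. Qed.

Definition joins g v v' := ((v == end1 g) && (v' == end2 g)) || ((v == end2 g) && (v' == end1 g)).

Lemma openrelP w v v' : reflect (exists2 g, w g & joins g v v') (openrel w v v').
Proof.
have E g : joins g v v' = (((emb g).1 == val v) && (zend2 (emb g) == val v') ||
      ((emb g).1 == val v') && (zend2 (emb g) == val v)).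
  rewrite /joins -!val_eqE (eq_sym (val v)) (eq_sym (val v')) (eq_sym (val v)) (eq_sym (val v')).
  by rewrite [X in _ || X]andbC.
by apply: (iffP existsP) => -[g]; [move=> /andP [wg]|move=> wg]; rewrite -?E => H;
  exists g; rewrite ?wg -?E.
Qed.

Lemma openrel_sym w : symmetric (openrel w).
Proof.
move=> v v'; apply/openrelP/openrelP => -[g wg] H; exists g => //; move: H; rewrite /joins;
by rewrite orbC andbC [X in _ || X]andbC.
Qed.

Local Notation aug := (augrel U j).

Lemma aug_sym w : symmetric (aug w).
Proof. by case=> [v|[]] [v'|[]] //=; exact: openrel_sym. Qed.

Lemma aug_connect_sym w : connect_sym (aug w).
Proof. exact/sym_connect_sym/aug_sym. Qed.

Lemma updE w e b g : upd w e b g = if g == e then b else w g.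
Proof. by rewrite ffunE. Qed.

Lemma aug_upd w e a b : aug (upd w e true) a b =
  [|| aug (upd w e false) a b, (a == inl (end1 e)) && (b == inl (end2 e))
    | (a == inl (end2 e)) && (b == inl (end1 e))].
Proof.
case: a b => [v|σ] [v'|σ'] //=; rewrite ?andbF ?orbF //.
rewrite -/(joins e v v'); apply/openrelP/orP => [[g]|[/openrelP [g]|H]].
- rewrite updE; case: eqP => [-> _|ne wg] H; [by right|left; apply/openrelP; exists g => //].
  by rewrite updE; case: eqP.
- by rewrite updE; case: eqP => // /eqP ne wg H; exists g => //; rewrite updE (negbTE ne).
- by exists e => //; rewrite updE eqxx.
Qed.

Lemma kTBE w : kTB U j w = nclasses (aug w). Proof. by []. Qed.

(** Connections through the two extra vertices count, as they do in [kTB]: closing [e] creates a new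
    component exactly when [linked] fails, so [theta] depends on the configuration through [linked]
    alone. *)
Definition linked w e := connect (aug (upd w e false)) (inl (end1 e)) (inl (end2 e)).

Lemma kTB_upd w e :
  kTB U j (upd w e false) = (kTB U j (upd w e true) + ~~ linked w e)%N.
Proof.
rewrite !kTBE; case: (boolP (linked w e)) => [ab|nab] /=.
  rewrite addn0 /nclasses; congr #|pred_of_set _|; apply: eq_imset => x; apply/setP => y.
  rewrite !inE; symmetry.
  exact: (connect_add_edge (aug_sym _) (aug_upd w e) ab).
rewrite addn1; exact: (nclasses_add_edge (aug_sym _) (aug_upd w e) nab).
Qed.

Lemma connect_invariant (V : finType) (r : rel V) (P : pred V) :
  (forall x y, r x y -> P x -> P y) -> forall x y, connect r x y -> P x -> P y.
Proof.
move=> H x y /connectP [p pp ->]; elim: p x pp => //= z p IH x /andP [/H xz /IH zp] /xz.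
exact: zp.
Qed.

(** A path between the extra vertices may visit them repeatedly. Rather than trimming it, one checks
    that [P], the T-vertex with all that T reaches by open edges, is invariant when T and B are not
    joined. *)
Lemma TBconnE w : TBconn U j w = connect (aug w) (inr true) (inr false).
Proof.
apply/existsP/idP => [[v /existsP [v' /and3P [Tv Bv' vv']]]|C].
  apply: (@connect_trans _ _ (inl v)); first exact: connect1.
  apply: (@connect_trans _ _ (inl v')); last exact: connect1.
  case/connectP: vv' => p + ->; elim: p v {Tv} => [|z p IH] v /=; first by rewrite connect0.
  by move=> /andP [vz /IH]; apply: connect_trans; apply: connect1.
apply: contrapT => nTB.
pose P a := match a with
  | inl v => [exists t, Tset U j t && connect (openrel w) t v]
  | inr b => b end.
suff : P (inr false) by [].
apply: (connect_invariant _ C isT) => -[v|[]] [v'|[]] //=.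
- move=> vv' /existsP [t /andP [Tt tv]]; apply/existsP; exists t; rewrite Tt.
  exact: connect_trans tv (connect1 vv').
- move=> Bv /existsP [t /andP [Tt tv]]; case: nTB; exists t; apply/existsP; exists v.
  by apply/and3P.
- by move=> Tv _; apply/existsP; exists v'; rewrite Tv connect0.
Qed.

(** The T-cluster for [b = true], the B-cluster for [b = false]. *)
Definition reach w (b : bool) v := connect (aug w) (inr b) (inl v).

Definition open_all w (D : pred (Et s)) : cfg s := [ffun g => D g || w g].

(** Opening edges that avoid one of the two clusters leaves that cluster unchanged, and it does not
    contain the other extra vertex. *)
Lemma openable w b (D : pred (Et s)) : ~~ TBconn U j w ->
  (forall g, D g -> ~~ reach w b (end1 g) /\ ~~ reach w b (end2 g)) ->
  ~~ TBconn U j (open_all w D).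
Proof.
rewrite !TBconnE => nTB H; apply: contra nTB => C.
have stp x y : aug (open_all w D) x y -> connect (aug w) (inr b) x -> connect (aug w) (inr b) y.
  case: x y => [v|σ] [v'|σ'] //=.
  - move=> /openrelP [g]; rewrite ffunE => /orP [/H [r1 r2]|wg] gv bv.
      case/orP: gv bv => /andP [/eqP -> /eqP ->] C'; first by rewrite /reach C' in r1.
      by rewrite /reach C' in r2.
    by apply: connect_trans bv (connect1 _); apply/openrelP; exists g.
  - by move=> E bv; apply: connect_trans bv (connect1 _).
  - by move=> E bv; apply: connect_trans bv (connect1 _).
  - by case: σ.
move: C; clear H; case: b stp => stp C; first exact: (connect_invariant stp C (connect0 _ _)).
rewrite aug_connect_sym; rewrite aug_connect_sym in C.
exact: (connect_invariant stp C (connect0 _ _)).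
Qed.

Definition meets w b ctr r := [exists v, inbox ctr r (val v) && reach w b v].
Definition calm ctr r w := ~~ (meets w true ctr r && meets w false ctr r).

(** One of the two clusters misses the box. The radius is [r.+1] because the second endpoint of an
    edge based in radius [r] may lie one unit further. *)
Lemma calm_openable w ctr r (D : pred (Et s)) : ~~ TBconn U j w -> calm ctr r.+1 w ->
  (forall g, D g -> inbox ctr r (base g)) -> ~~ TBconn U j (open_all w D).
Proof.
move=> nTB /nandP cw Din.
have [b nb] : exists b, ~~ meets w b ctr r.+1 by case: cw => ?; [exists true|exists false].
apply: (@openable w b) => // g /Din bg; move: nb; rewrite negb_exists => /forallP nb; split.
  by have := nb (end1 g); rewrite val_end1 (inbox_le _ bg) //.
by have := nb (end2 g); rewrite val_end2 -addn1 (inbox_trans bg (inbox_zmove _ _)).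
Qed.

(** Vanishing on the boundary, [h] extends by 0 to both extra vertices, and is then constant on
    every cluster of the augmented graph. *)
Lemma aug_const w (h : zpt d -> bool) :
  (forall g, w g -> h (zend2 (emb g)) = h (base g)) ->
  (forall v, bdry v -> h (val v) = false) ->
  forall a b, connect (aug w) a b ->
    (if a is inl v then h (val v) else false) = (if b is inl v then h (val v) else false).
Proof.
move=> hw hb a b; set hh := fun a : Vt s + bool => if a is inl v then h (val v) else false.
have cl x y : aug w x y -> hh x = hh y.
  case: x y => [v|σ] [v'|σ'] //=.
  - move=> /openrelP [g wg] /orP [] /andP [/eqP -> /eqP ->];
    by rewrite val_end1 val_end2 hw.
  - by case: σ' => /andP [/hb ->].
  - by case: σ => /andP [/hb ->].
move=> ab; apply/eqP; rewrite -/(hh a) -/(hh b) eq_sym.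
by apply: (connect_invariant _ ab (P := fun x => hh x == hh a)) => [x y /cl ->|].
Qed.

Lemma bdry_box ctr r v : (forall x, inbox ctr r.+1 x -> x \in s) -> bdry v ->
  ~~ inbox ctr r (val v).
Proof.
move=> bs /existsP [i vi]; apply: contraL vi => bv; rewrite negb_or !negbK.
by rewrite !bs // -addn1; apply: inbox_trans bv _; [exact: inbox_zmoveN|exact: inbox_zmove].
Qed.

Lemma reach_disj w v : ~~ TBconn U j w -> reach w true v -> ~~ reach w false v.
Proof.
rewrite TBconnE => nTB rv; apply: contra nTB => rv'; apply: connect_trans rv _.
by rewrite aug_connect_sym.
Qed.

Lemma pivotal_reach w g b : ~~ TBconn U j w -> pivotal U j w g ->
  reach w b (end1 g) || reach w b (end2 g).
Proof.
move=> nTB; apply: contraLR; rewrite negb_or /pivotal => /andP [n1 n2].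
have -> : upd w g true = open_all w (pred1 g).
  by apply/ffunP => e; rewrite !ffunE /=; case: eqP.
by apply: (openable (b := b)) => // e /eqP ->.
Qed.

Lemma reach_upd w g b v : reach w b v -> reach (upd w g true) b v.
Proof.
apply: connect_sub => -[x|σ] [y|σ'] // xy; apply: connect1 => //; move: xy => /=.
move=> /openrelP [e we xy]; apply/openrelP; exists e => //.
by rewrite updE we; case: eqP.
Qed.

Lemma reach_pivotal w g b : reach w b (end1 g) -> reach w (~~ b) (end2 g) ->
  pivotal U j w g.
Proof.
move=> r1 r2; rewrite /pivotal TBconnE.
have C : connect (aug (upd w g true)) (inr b) (inr (~~ b)).
  apply: connect_trans (reach_upd g r1) _.
  rewrite aug_connect_sym; apply: connect_trans (reach_upd g r2) (connect1 _).
  by rewrite aug_upd !eqxx !orbT.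
by case: b C {r1 r2}; rewrite // aug_connect_sym.
Qed.

(** [A] is the T-cluster, whose cut edges are closed. If no walk of cut edges leaves the large box,
    the potential [h] given by [cut_dichotomy] vanishes on both clusters, which are attached to the
    boundary; and [h (+) A] is constant on the small box, where every cut edge belongs to [D]. But
    [A] takes both values where the two clusters meet that box. A cut edge has exactly one endpoint
    in the T-cluster, hence is pivotal as soon as it touches the B-cluster. *)
Lemma not_calm_walk w ctr r l (i0 i1 : 'I_d) : i0 != i1 ->
  (forall x, inbox ctr (r + l).+2 x -> x \in s) ->
  ~~ TBconn U j w -> ~~ calm ctr r w ->
  exists f p, [/\ inbox ctr r (base f), p \in walks (@eadj d s) l.+1 f, uniq (f :: p)
    & all (fun g => [&& ~~ w g, inbox ctr (r + l).+1 (base g)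
        & pivotal U j w g || ~~ reach w false (end1 g) && ~~ reach w false (end2 g)]) (f :: p)].
Proof.
move=> i01 bs nTB; rewrite negbK => /andP [mT mB].
pose A (x : zpt d) := [exists v, (val v == x) && reach w true v].
have AE v : A (val v) = reach w true v.
  apply/existsP/idP => [[v' /andP [/eqP /val_inj -> //]]|H]; by exists v; rewrite eqxx.
have cutE g : cutting A g = reach w true (end1 g) (+) reach w true (end2 g).
  by rewrite /cutting -val_end1 -val_end2 !AE.
have cut_closed g : cutting A g -> ~~ w g.
  rewrite cutE; apply: contraL => wg.
  have E : aug w (inl (end1 g)) (inl (end2 g)).
    by apply/openrelP; exists g; rewrite // /joins !eqxx.
  rewrite /reach (same_connect_r (aug_connect_sym w) (connect1 E)) addbb //.
pose S0 g := cutting A g && inbox ctr r (base g).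
have [||] := @cut_dichotomy d s ctr (r + l) A S0 _ _ i01 bs.
- by move=> g /andP [-> /inbox_le ->] //; lia.
- move=> [f [p [S0f pp up Sp out]]].
  have lp : (l < size p)%N.
    rewrite ltnNge; apply: contra out => lp; apply: (@inbox_le _ _ (r + size p)); first lia.
    by move/andP: S0f => [_ bf]; apply: inbox_trans bf (path_inbox pp).
  have [cf bf] := andP S0f.
  exists f, (take l.+1 p); split=> //.
  + apply/walksP; split; first by rewrite size_takel.
    by move: pp; rewrite -{1}(cat_take_drop l.+1 p) cat_path => /andP [].
  + by move: up; rewrite -{1}(cat_take_drop l.+1 p) -cat_cons cat_uniq => /andP [].
  + apply/allP => g gp; have {gp} /andP [cg ->] : cutting A g && inbox ctr (r + l).+1 (base g).
      move: gp; rewrite inE => /orP [/eqP ->|/mem_take]; last by apply/allP: g.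
      by rewrite cf (inbox_le _ bf) // leqW // leq_addr.
    rewrite cut_closed //=; apply/orP.
    case: (boolP (reach w false (end1 g) || reach w false (end2 g))) => [rr|]; last first.
      by rewrite negb_or; right.
    left; move: cg; rewrite cutE; case/orP: rr => rr.
      have : ~~ reach w true (end1 g) by apply: contraL rr; exact: reach_disj.
      by move=> /negbTE -> /= r2; apply: (reach_pivotal (b := false)).
    have : ~~ reach w true (end2 g) by apply: contraL rr; exact: reach_disj.
    by move=> /negbTE ->; rewrite addbF => r2; apply: (reach_pivotal (b := true)).
move=> [h [D [S0D DP hD h0]]].
have DS g : D g -> cutting A g && inbox ctr (r + l).+1 (base g).
  move=> /DP [f [p [/andP [cf bf] _ _ Sp <-]]].
  case/lastP: p Sp => [|p q] /=; first by rewrite cf (inbox_le _ bf) // leqW // leq_addr.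
  by rewrite all_rcons last_rcons => /andP [].
have hE g : h (zend2 (emb g)) = h (base g) (+) D g.
  rewrite hD; congr (_ (+) _); apply/existsP/idP => [[g' /andP [Dg']]|Dg].
    by rewrite -surjective_pairing => /eqP /emb_inj <-.
  by exists g; rewrite Dg -surjective_pairing eqxx.
have const := @aug_const w h.
have {}const : forall b v, reach w b v -> h (val v) = false.
  move=> b v rv; rewrite -(const _ _ _ _ rv) //.
    move=> g wg; rewrite hE; case: (boolP (D g)) => [/DS /andP [/cut_closed]|_]; last by rewrite addbF.
    by rewrite wg.
  by move=> v' bv; apply: h0; apply: bdry_box bv.
(* Along an edge of the small box both [h] and [A] change exactly when the edge is a cut edge. *)
have step x i : inbox ctr r x -> inbox ctr r (zmove x i 1) ->
    h (zmove x i 1) (+) A (zmove x i 1) = h x (+) A x.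
  move=> bx bx'; have [||g Eg] := @embP d s x i.
  - by apply: bs; apply: inbox_le bx; lia.
  - by apply: bs; apply: inbox_le bx'; lia.
  have := hE g; rewrite /zend2 /base Eg /= => ->.
  have -> : D g = A x (+) A (zmove x i 1).
    have -> : A x (+) A (zmove x i 1) = cutting A g by rewrite /cutting /base /zend2 Eg.
    apply/idP/idP => [/DS /andP [] //|cg]; apply: S0D; rewrite /S0 cg /base Eg //.
  by case: (h x); case: (A x); case: (A _).
have wk := inbox_walk step.
case/existsP: mT => v /andP [bv rv]; case/existsP: mB => v' /andP [bv' rv'].
have := wk _ bv; rewrite -(wk _ bv') (const _ _ rv) (const _ _ rv') !AE rv.
have -> : reach w true v' = false.
  by apply/negbTE; apply: contraL rv'; exact: reach_disj.
by [].
Qed.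

(** [A] is the cluster in Y, with [f] closed, of one endpoint of [f]; hence [f] is a cut edge.
    Suppose that no cut walk from [f] leaves the box and that [D] has no edge other than [f] open in
    X. Then [h] is constant on the clusters of X with [f] closed, so it agrees at the two ends of
    [f], whereas [f] being in [D] makes them differ. *)
Lemma discrepancy_walk (X Y : cfg s) f ctr r (i0 i1 : 'I_d) : i0 != i1 ->
  (forall x, inbox ctr r.+2 x -> x \in s) -> inbox ctr r (base f) ->
  linked X f -> ~~ linked Y f ->
  exists p, [/\ path (@eadj d s) f p, uniq (f :: p),
     all (fun g => ~~ Y g && inbox ctr r.+1 (base g)) p
   & ~~ inbox ctr r (base (last f p)) || [&& last f p != f, X (last f p) & ~~ Y (last f p)]].
Proof.
move=> i01 bs bf lX lY.
pose Y' := upd Y f false.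
pose A (x : zpt d) := [exists v, (val v == x) && connect (aug Y') (inl (end1 f)) (inl v)].
have AE v : A (val v) = connect (aug Y') (inl (end1 f)) (inl v).
  apply/existsP/idP => [[v' /andP [/eqP /val_inj -> //]]|H]; by exists v; rewrite eqxx.
have cut_closed g : cutting A g -> ~~ Y' g.
  rewrite /cutting -val_end1 -val_end2 !AE; apply: contraL => wg.
  have E : aug Y' (inl (end1 g)) (inl (end2 g)).
    by apply/openrelP; exists g; rewrite // /joins !eqxx.
  by rewrite (same_connect_r (aug_connect_sym Y') (connect1 E)) addbb.
have clos p : uniq (f :: p) -> all (fun g => cutting A g && inbox ctr r.+1 (base g)) p ->
    all (fun g => ~~ Y g && inbox ctr r.+1 (base g)) p.
  move=> /= /andP [fp _] /allP Sp; apply/allP => g gp.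
  have /andP [/cut_closed + ->] := Sp g gp; rewrite updE andbT.
  by case: eqP => // E _; rewrite -E gp in fp.
have [||] := @cut_dichotomy d s ctr r A (pred1 f) _ _ i01 bs.
- move=> g /eqP ->; rewrite (inbox_le _ bf) // andbT /cutting -val_end1 -val_end2 !AE connect0.
  by rewrite -/(linked Y f) (negbTE lY).
- by move=> [_ [p [/eqP -> pp up /clos Sp out]]]; exists p; rewrite out; split=> //; apply: Sp.
move=> [h [D [S0D DP hD h0]]].
have hE g : h (zend2 (emb g)) = h (base g) (+) D g.
  rewrite hD; congr (_ (+) _); apply/existsP/idP => [[g' /andP [Dg']]|Dg].
    by rewrite -surjective_pairing => /eqP /emb_inj <-.
  by exists g; rewrite Dg -surjective_pairing eqxx.
have [/existsP [g /andP [Dg Xg]]|no] := boolP [exists g, D g && upd X f false g].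
  have gf : g != f by apply: contraTneq Xg => ->; rewrite updE eqxx.
  move: Xg; rewrite updE (negbTE gf) => Xg.
  have [_ [p [/eqP -> pp up Sp lp]]] := DP g Dg.
  have Cp := clos _ up Sp.
  exists p; split=> //; rewrite lp gf Xg /=.
  suff gp : g \in p by move/allP: Cp => /(_ g gp) /andP [->]; rewrite orbT.
  by move: (mem_last f p); rewrite lp inE (negbTE gf).
move: no; rewrite negb_exists => /forallP no.
have := aug_const _ _ lX; move=> /(_ h); rewrite val_end1 val_end2 hE S0D /= ?eqxx //.
move=> H; suff : h (base f) = h (base f) (+) true by case: (h _).
apply: H => [g Xg|v bv]; last by apply: h0; apply: bdry_box bv.
by have := no g; rewrite Xg andbT hE => /negbTE ->; rewrite addbF.
Qed.

End Aug.

(** * Update probabilities *)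

Section Thresholds.
Variable R : realType.
Local Open Scope classical_set_scope.
Local Notation mu := (@lebesgue_measure R).

(* [a] and [b] are the thresholds of X and Y; [pv] says that the updated edge is
   pivotal for Y. *)
Definition split_mass (a b : R) (pv bx y : bool) : R :=
  fine (mu [set u | (0 <= u <= 1) /\ ((a <= u) = bx /\ ((b <= u) && ~~ pv) = y)]).

Lemma split_mass_ge0 a b pv bx y : 0 <= split_mass a b pv bx y.
Proof. exact/fine_ge0/measure_ge0. Qed.

Let A (b : R) (pv y : bool) : set R := [set u | (0 <= u <= 1) /\ ((b <= u) && ~~ pv) = y].

Let mge (a : R) : measurable [set u : R | a <= u].
Proof.
rewrite (_ : [set _ | _] = [set` `[a, +oo[%R]); first exact: measurable_itv.
by apply/seteqP; split=> u /=; rewrite in_itv /= andbT.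
Qed.

Let mlt (a : R) : measurable [set u : R | (a <= u) = false].
Proof.
rewrite (_ : [set _ | _] = ~` [set u : R | a <= u]); first exact: measurableC.
by apply/seteqP; split=> u /=; [move=> -> | move=> /negP/negbTE ->].
Qed.

Let m01 : measurable [set u : R | 0 <= u <= 1].
Proof.
rewrite (_ : [set _ | _] = [set` `[0 : R, 1]%R]); first exact: measurable_itv.
by apply/seteqP; split=> u /=; rewrite in_itv.
Qed.

Let mA b pv y : measurable (A b pv y).
Proof.
rewrite (_ : A b pv y = [set u : R | 0 <= u <= 1] `&`
  (if pv then (if y then set0 else setT)
   else if y then [set u : R | b <= u] else [set u : R | (b <= u) = false])).
  by apply: measurableI => //; case: pv; case: y.
by case: pv; case: y; apply/seteqP; split=> u; rewrite /A /= ?andbF ?andbT; intuition.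
Qed.

Let fin (B : set R) : measurable B -> B `<=` [set u : R | 0 <= u <= 1] -> mu B \is a fin_num.
Proof.
move=> mB sB; rewrite ge0_fin_numE //; apply: (@le_lt_trans _ _ (mu [set` `[0 : R, 1]%R])).
  by apply: le_measure; rewrite ?inE //; move=> u /sB; rewrite /= in_itv.
by rewrite lebesgue_measure_itv /= lte_fin ltr01 -EFinD ltry.
Qed.

Let sumA a b pv y :
  split_mass a b pv true y + split_mass a b pv false y = fine (mu (A b pv y)).
Proof.
have E bx : [set u | (0 <= u <= 1) /\ ((a <= u) = bx /\ ((b <= u) && ~~ pv) = y)] =
   A b pv y `&` [set u : R | (a <= u) = bx].
  by apply/seteqP; split=> u /=; [case=> ? []|case=> -[]].
have mS bx : measurable [set u : R | (a <= u) = bx] by case: bx; [exact: mge|exact: mlt].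
rewrite /split_mass !E -fineD; first last.
- by apply: fin; [by apply: measurableI; [exact: mA|exact: mS]|move=> u [] []].
- by apply: fin; [by apply: measurableI; [exact: mA|exact: mS]|move=> u [] []].
rewrite -measureU //; first last.
- by apply/seteqP; split=> // u /= [[_ ->] []].
- by apply: measurableI; [exact: mA|exact: mS].
- by apply: measurableI; [exact: mA|exact: mS].
congr (fine (mu _)); apply/seteqP; split=> u /=; first by case=> -[].
by case=> h1 h2; case: (a <= u); [left|right].
Qed.

Lemma split_mass_open a b pv : 0 <= b <= 1 ->
  split_mass a b pv true true + split_mass a b pv false true = if pv then 0 else 1 - b.
Proof.
move=> /andP [b0 b1]; rewrite sumA; case: pv.
  rewrite (_ : A _ _ _ = set0) ?measure0 //.
  by apply/seteqP; split=> // u [_] /=; rewrite andbF.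
rewrite (_ : A _ _ _ = [set` `[b, 1]%R]).
  rewrite lebesgue_measure_itv /= lte_fin.
  by case: ltP => // b1'; rewrite (@le_anti _ _ b 1) ?b1 // subrr.
apply/seteqP; split=> u; rewrite /A /= in_itv /= ?andbT; first by move=> [/andP [_ u1] bu]; rewrite bu u1.
by move=> /andP [bu u1]; rewrite bu u1 (le_trans b0 bu).
Qed.

Lemma split_mass_closed a b pv : 0 <= b <= 1 ->
  split_mass a b pv true false + split_mass a b pv false false = if pv then 1 else b.
Proof.
move=> /andP [b0 b1]; rewrite sumA; case: pv.
  rewrite (_ : A _ _ _ = [set` `[0 : R, 1]%R]).
    by rewrite lebesgue_measure_itv /= lte_fin ltr01 /= subr0.
  by apply/seteqP; split=> u; rewrite /A /= in_itv /= andbF; [case|].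
rewrite (_ : A _ _ _ = [set` `[0, b[%R]).
  rewrite lebesgue_measure_itv /= lte_fin.
  case: ltP => //= b0'; first by rewrite subr0.
  by apply/le_anti; rewrite b0 b0'.
apply/seteqP; split=> u; rewrite /A /= in_itv /= ?andbT ltNge; first by move=> [/andP [u0 _] bu]; rewrite u0 bu.
by move=> /andP [u0 bu]; rewrite u0 (negbTE bu) /= (le_trans _ b1) // ltW // ltNge.
Qed.

Lemma split_mass_mixed a b : b <= a -> split_mass a b false true false = 0.
Proof.
move=> ba; rewrite /split_mass (_ : [set _ | _] = set0) ?measure0 //.
apply/seteqP; split=> // u /= [_ [au]]; rewrite andbT => bu.
by move: (le_trans ba au); rewrite bu.
Qed.

End Thresholds.

Section Theta.
Variables (R : realType) (d : nat) (s : seq (zpt d)) (U : 'M[R]_d) (j : 'I_d) (p q : R).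
Implicit Types (w : cfg s) (e : Et s).
Hypotheses (p0 : 0 < p) (p1 : p < 1) (q1 : 1 <= q).

Let q0 : 0 < q. Proof. exact: lt_le_trans ltr01 q1. Qed.
Let np0 : 0 < 1 - p. Proof. by rewrite subr_gt0. Qed.

Local Notation FK := (FKweight U j p q).
Local Notation th := (theta U j p q).

Lemma FKweight_gt0 w : 0 < FK w.
Proof.
apply: mulr_gt0; last exact: exprn_gt0.
by apply: prodr_gt0 => e _; case: ifP.
Qed.

Definition oddsc : R := (1 - p) / p.

Lemma oddsc_gt0 : 0 < oddsc. Proof. exact: divr_gt0. Qed.

Lemma FKweight_upd w e :
  FK (upd w e false) = oddsc * q ^+ (~~ linked U j w e) * FK (upd w e true).
Proof.
rewrite /FKweight kTB_upd exprD /oddsc.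
rewrite (bigD1 e) //= [in RHS](bigD1 e) //= !updE eqxx.
rewrite [in LHS](eq_bigr (fun e0 => if upd w e true e0 then p else 1 - p)); last first.
  by move=> g /negbTE ge; rewrite !updE ge.
have : p != 0 by rewrite gt_eqF.
move: (\prod_(_ | _) _) (q ^+ _) (q ^+ _) => P a b pn.
by field.
Qed.

Lemma FKsum_gt0 : 0 < \sum_(w : cfg s) FK w.
Proof.
rewrite (bigD1 [ffun=> true]) //= ltr_pwDl ?FKweight_gt0 // sumr_ge0 // => w _.
exact/ltW/FKweight_gt0.
Qed.

Lemma PhiTB_gt0 w : 0 < PhiTB U j p q w.
Proof. exact: divr_gt0 (FKweight_gt0 _) FKsum_gt0. Qed.

Lemma PhiTB_upd w e :
  PhiTB U j p q (upd w e false) = oddsc * q ^+ (~~ linked U j w e) * PhiTB U j p q (upd w e true).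
Proof. by rewrite /PhiTB FKweight_upd mulrA. Qed.

Lemma thetaE w e : th w e =
  oddsc * q ^+ (~~ linked U j w e) / (1 + oddsc * q ^+ (~~ linked U j w e)).
Proof.
rewrite /theta PhiTB_upd; set t := _ * _ ^+ _.
have t0 : 0 < t by rewrite mulr_gt0 ?oddsc_gt0 // exprn_gt0.
have := PhiTB_gt0 (upd w e true); move: (PhiTB _ _ _ _ _) => P P0.
have t1 : 0 < 1 + t by rewrite addr_gt0.
rewrite -{2}[P]mul1r -mulrDl -mulf_div divff ?mulr1 // gt_eqF //.
Qed.

(** The largest ratio between the weights with an edge closed and with it open. It bounds [theta]
    and is also the Peierls cost of a closed edge. *)
Definition eps : R := oddsc * q.

Let t_le b : oddsc * q ^+ (~~ b) <= eps.
Proof. by case: b; rewrite ler_pM2l ?oddsc_gt0 //= ?expr0 ?expr1. Qed.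

Let t_gt0 b : 0 < oddsc * q ^+ (~~ b).
Proof. by rewrite mulr_gt0 ?oddsc_gt0 // exprn_gt0. Qed.

Lemma eps_gt0 : 0 < eps. Proof. by rewrite mulr_gt0 // oddsc_gt0. Qed.

Lemma theta_gt0 w e : 0 < th w e.
Proof. by rewrite thetaE divr_gt0 // addr_gt0. Qed.

Lemma theta_le_eps w e : th w e <= eps.
Proof.
rewrite thetaE; apply: le_trans (t_le (linked U j w e)).
move: (t_gt0 (linked U j w e)); move: (_ * _) => t t0.
by rewrite ler_pdivrMr ?addr_gt0 //; nra.
Qed.

Lemma theta_lt1 w e : th w e < 1.
Proof. by rewrite thetaE ltr_pdivrMr ?mul1r ?addr_gt0 // ltrDr. Qed.

Lemma theta_01 w e : 0 <= th w e <= 1.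
Proof. by rewrite ltW ?theta_gt0 // ltW ?theta_lt1. Qed.

(** [theta] has at most two values, and since [q >= 1] the smaller one is that of a linked edge. *)
Lemma theta_lt_linked w w' e : th w e < th w' e -> linked U j w e && ~~ linked U j w' e.
Proof.
rewrite !thetaE; case: (linked _ _ w e); case: (linked _ _ w' e) => //=; rewrite ?ltxx //.
move: oddsc_gt0; rewrite expr0 expr1 => o0; rewrite ltNge => /negP []; rewrite mulr1.
have oq : 0 < oddsc * q by rewrite mulr_gt0.
move: oddsc o0 oq => o o0 oq; clear p0 p1 q0 np0.
rewrite ler_pdivrMr ?addr_gt0 // mulrAC ler_pdivlMr ?addr_gt0 //.
by rewrite !mulrDr !mulr1 mulrA (mulrAC o q o) lerD2r ler_peMr // ltW.
Qed.

Lemma theta_upd w e b : th (upd w e b) e = th w e.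
Proof.
have E b' : upd (upd w e b) e b' = upd w e b'.
  by apply/ffunP => g; rewrite !updE; case: eqP.
by rewrite /theta !E.
Qed.

End Theta.

Section Kernel.
Variables (R : realType) (d : nat) (s : seq (zpt d)) (U : 'M[R]_d) (j : 'I_d) (p q : R).
Implicit Types (st : cfg s * cfg s) (e : Et s).

Definition flip_mass st e (b : bool * bool) : R :=
  split_mass (theta U j p q st.1 e) (theta U j p q st.2 e) (pivotal U j st.2 e) b.1 b.2.

Lemma upd_inj (w : cfg s) e : injective (upd w e).
Proof. by move=> b b' /ffunP /(_ e); rewrite !updE eqxx. Qed.

(** One update only decides the two bits at [e], and distinct bits give distinct states: the sum
    over states collapses to four outcomes per edge. *)
Lemma kernelE st (g : cfg s * cfg s -> R) :
  \sum_st' Defs.kernel U j p q st st' * g st' =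
  (#|{: Et s}|%:R)^-1 * \sum_e \sum_b flip_mass st e b * g (upd st.1 e b.1, upd st.2 e b.2).
Proof.
pose phi e (b : bool * bool) := (upd st.1 e b.1, upd st.2 e b.2).
have key e st' : fine (lebesgue_measure [set u : R | (0 <= u <= 1) /\ step U j p q st e u = st'])
    = \sum_b (if phi e b == st' then flip_mass st e b else 0).
  have [/existsP [b /eqP <-]|] := boolP [exists b, phi e b == st'].
    rewrite (bigD1 b) //= eqxx big1 ?addr0.
      rewrite /flip_mass /split_mass; congr (fine (_ _)).
      apply/seteqP; split=> u /= [u01]; rewrite /step.
        by move=> [] /upd_inj <- /upd_inj <-.
      by move=> [-> ]; rewrite /pivotal => ->.
    move=> b' ne; case: eqP => // -[] /upd_inj e1 /upd_inj e2.
    by case/eqP: ne; rewrite (surjective_pairing b) -e1 -e2 -surjective_pairing.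
  rewrite negb_exists => /forallP no.
  rewrite big1; last by move=> b _; rewrite (negbTE (no b)).
  rewrite (_ : [set _ | _]%classic = classical_sets.set0) ?measure0 //.
  apply/seteqP; split=> // u /= [_ E].
  by case/eqP: (no (theta U j p q st.1 e <= u,
    (theta U j p q st.2 e <= u) && ~~ TBconn U j (upd st.2 e true))).
rewrite /Defs.kernel; under eq_bigr do rewrite -mulrA; rewrite -mulr_sumr; congr (_ * _).
under eq_bigr do rewrite mulr_suml; rewrite exchange_big /=; apply: eq_bigr => e _.
under eq_bigr do rewrite key mulr_suml; rewrite exchange_big /=; apply: eq_bigr => b _.
rewrite (bigD1 (phi e b)) //= eqxx big1 ?addr0 // => st' /negbTE ne.
by rewrite eq_sym ne mul0r.
Qed.

End Kernel.

(** * The marginal chain Y *)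

Section YChain.
Variables (R : realType) (d : nat) (s : seq (zpt d)) (U : 'M[R]_d) (j : 'I_d) (p q : R).
Hypotheses (p0 : 0 < p) (p1 : p < 1) (q1 : 1 <= q) (Npos : (0 < #|{: Et s}|)%N).
Implicit Types (w : cfg s) (e g : Et s) (f h : cfg s -> R) (F : {set Et s}).

Local Notation th := (theta U j p q).
Local Notation TB := (TBconn U j).
Local Notation N := #|{: Et s}|.
Local Notation Phi := (PhiTB U j p q).

Definition open_prob w e : R := if pivotal U j w e then 0 else 1 - th w e.

(** The Markov operator of Y on observables: [iter n Qop f] is an expectation after [n] steps, and
    the innermost [Qop] is the last step in time. *)
Definition Qop f w : R :=
  (N%:R)^-1 * \sum_e (open_prob w e * f (upd w e true) + (1 - open_prob w e) * f (upd w e false)).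

Lemma open_prob_01 w e : 0 <= open_prob w e <= 1.
Proof.
rewrite /open_prob; case: ifP; first by rewrite lexx ler01.
have /andP [t0 t1] := theta_01 U j p0 p1 q1 w e; lra.
Qed.

Lemma upd_upd w e b b' : upd (upd w e b) e b' = upd w e b'.
Proof. by apply/ffunP => g; rewrite !updE; case: eqP. Qed.

Lemma upd_id w e : upd w e (w e) = w.
Proof. by apply/ffunP => g; rewrite updE; case: eqP => // ->. Qed.

Lemma open_prob_upd w e b : open_prob (upd w e b) e = open_prob w e.
Proof. by rewrite /open_prob /pivotal upd_upd theta_upd. Qed.

Lemma TBconn_mono w w' : (forall e, w e -> w' e) -> TB w -> TB w'.
Proof.
move=> le; rewrite !TBconnE; apply: connect_sub => -[x|σ] [y|σ'] xy; apply: connect1 => //.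
by move: xy => /= /openrelP [e we xy]; apply/openrelP; exists e => //; apply: le.
Qed.

Lemma disc_close w e : ~~ TB w -> ~~ TB (upd w e false).
Proof. by apply: contra; apply: TBconn_mono => g; rewrite updE; case: eqP. Qed.

Lemma disc_open w e : ~~ TB w -> 0 < open_prob w e -> ~~ TB (upd w e true).
Proof. by rewrite /open_prob /pivotal; case: (TB (upd w e true)); rewrite ?ltxx. Qed.

(** A comparison on disconnected configurations suffices, because a step never leaves them: closing
    preserves disconnection, and a pivotal edge opens with probability 0. *)
Lemma Qop_le f h : (forall w, ~~ TB w -> f w <= h w) ->
  forall w, ~~ TB w -> Qop f w <= Qop h w.
Proof.
move=> fh w nT; rewrite ler_wpM2l ?invr_ge0 ?ler0n // ler_sum // => e _.
have /andP [a0 a1] := open_prob_01 w e.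
apply: lerD; last by apply: ler_wpM2l; [rewrite subr_ge0|apply/fh/disc_close].
case: (eqVneq (open_prob w e) 0) => [->|ne]; first by rewrite !mul0r.
have {}a0 : 0 < open_prob w e by rewrite lt_def ne.
by rewrite (ler_pM2l a0); apply/fh/disc_open.
Qed.

Lemma iter_Qop_le n f h : (forall w, ~~ TB w -> f w <= h w) ->
  forall w, ~~ TB w -> iter n Qop f w <= iter n Qop h w.
Proof. by move=> fh; elim: n => // n IH w nT; apply: Qop_le. Qed.

Lemma Qop_cst c w : Qop (fun=> c) w = c.
Proof.
rewrite /Qop (eq_bigr (fun=> c)) => [|e _]; last by ring.
by rewrite sumr_const -[c *+ _]mulr_natr mulrCA mulVf ?mulr1 // pnatr_eq0 -lt0n.
Qed.

Lemma Qop_lin a f h w : Qop (fun w => a * f w + h w) w = a * Qop f w + Qop h w.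
Proof.
rewrite /Qop mulrCA -mulrDr; congr (_ * _); rewrite mulr_sumr -big_split /=.
by apply: eq_bigr => e _; ring.
Qed.

Lemma Qop_ext f h : f =1 h -> Qop f =1 Qop h.
Proof. by move=> E w; rewrite /Qop; congr (_ * _); apply: eq_bigr => e _; rewrite !E. Qed.

Lemma iter_Qop_ext n f h : f =1 h -> iter n Qop f =1 iter n Qop h.
Proof. by move=> E; elim: n => // n IH; apply: Qop_ext. Qed.

Lemma iter_Qop_lin n a f h w :
  iter n Qop (fun w => a * f w + h w) w = a * iter n Qop f w + iter n Qop h w.
Proof. by elim: n w => // n IH w; rewrite !iterS (Qop_ext IH) Qop_lin. Qed.

Lemma iter_Qop_sum n (I : Type) (r : seq I) (G : I -> cfg s -> R) w :
  iter n Qop (fun w => \sum_(i <- r) G i w) w = \sum_(i <- r) iter n Qop (G i) w.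
Proof.
elim: r => [|i r IH].
  rewrite big_nil (iter_Qop_ext _ (h := fun=> 0)); last by move=> v; rewrite big_nil.
  by elim: n w => // n IH w; rewrite iterS (Qop_ext IH) Qop_cst.
rewrite big_cons -IH -[X in X + _]mul1r -iter_Qop_lin; apply: iter_Qop_ext => v.
by rewrite big_cons mul1r.
Qed.

Lemma iter_Qop_scale n a f w : iter n Qop (fun w => a * f w) w = a * iter n Qop f w.
Proof.
elim: n w => // n IH w; rewrite !iterS (Qop_ext IH) /Qop mulrCA; congr (_ * _).
by rewrite mulr_sumr; apply: eq_bigr => e _; ring.
Qed.

Lemma iter_Qop_cst n c w : iter n Qop (fun=> c) w = c.
Proof. by elim: n w => // n IH w; rewrite iterS (Qop_ext IH) Qop_cst. Qed.

Lemma iter_Qop_ge0 n f : (forall w, ~~ TB w -> 0 <= f w) ->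
  forall w, ~~ TB w -> 0 <= iter n Qop f w.
Proof. by move=> f0 w nT; rewrite -(iter_Qop_cst n 0 w); apply: iter_Qop_le. Qed.

Lemma iter_Qop_le1 n f : (forall w, ~~ TB w -> f w <= 1) ->
  forall w, ~~ TB w -> iter n Qop f w <= 1.
Proof. by move=> f0 w nT; rewrite -(iter_Qop_cst n 1 w); apply: iter_Qop_le. Qed.

Definition closed_cfg : cfg s := [ffun=> false].

Lemma disc_closed_cfg : ~~ TB closed_cfg.
Proof.
rewrite TBconnE; apply/negP => C.
pose P (a : Vt s + bool) := match a with inl v => Tset U j v | inr b => b end.
suff : P (inr false) by [].
apply: (connect_invariant _ C isT) => -[v|[]] [v'|[]] //=.
  by move=> /openrelP [g]; rewrite ffunE.
by rewrite /Bset /Tset => /andP [-> /negbTE ->].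
Qed.

Definition Zdisc : R := \sum_(w : cfg s | ~~ TB w) Phi w.

Lemma Zdisc_gt0 : 0 < Zdisc.
Proof.
rewrite /Zdisc (bigD1 closed_cfg disc_closed_cfg) /= ltr_pwDl ?PhiTB_gt0 //.
by apply: sumr_ge0 => w _; exact/ltW/PhiTB_gt0.
Qed.

Definition cond_law w : R := if TB w then 0 else Phi w / Zdisc.
Local Notation pi := cond_law.

Lemma cond_law_gt0 w : ~~ TB w -> 0 < pi w.
Proof. by rewrite /cond_law => /negbTE ->; rewrite divr_gt0 ?PhiTB_gt0 ?Zdisc_gt0. Qed.

Lemma cond_law_ge0 w : 0 <= pi w.
Proof. by case: (boolP (TB w)) => [|/cond_law_gt0/ltW //]; rewrite /cond_law => ->. Qed.

Lemma sum_cond_law : \sum_w pi w = 1.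
Proof.
rewrite (bigID (fun w => TB w)) /= big1 ?add0r; last by move=> w; rewrite /cond_law => ->.
rewrite (eq_bigr (fun w => Phi w / Zdisc)); last by move=> w; rewrite /cond_law => /negbTE ->.
by rewrite -mulr_suml divff // gt_eqF ?Zdisc_gt0.
Qed.

(** If [e] is pivotal both sides vanish, the left one because the law gives no mass to connected
    configurations. Otherwise this is the definition of [theta]. *)
Lemma balance w e :
  pi (upd w e true) * (1 - open_prob w e) = pi (upd w e false) * open_prob w e.
Proof.
rewrite /cond_law /open_prob /pivotal; case: ifP => [_|/negbT nT]; first by rewrite mul0r mulr0.
have -> : TB (upd w e false) = false.
  by apply/negbTE; rewrite -(upd_upd w e true); apply: disc_close.
rewrite opprB addrCA subrr addr0 mulrAC [RHS]mulrAC; congr (_ / _).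
rewrite /theta; have := PhiTB_gt0 U j p0 p1 q1 (upd w e true).
have := PhiTB_gt0 U j p0 p1 q1 (upd w e false).
move: (Phi _) (Phi _) => a b a0 b0.
have ne : b + a != 0 by rewrite gt_eqF // addr_gt0.
by field; rewrite ?ne // addrC ne.
Qed.

(** Flipping [e] is an involution. Regrouping configurations in pairs that differ at [e] is what
    lets [balance] act inside a sum. *)
Lemma sum_flip e f : \sum_w f w + \sum_w f w = \sum_w (f (upd w e true) + f (upd w e false)).
Proof.
pose fl w := upd w e (~~ w e).
have flK : involutive fl by move=> w; rewrite /fl upd_upd updE eqxx negbK upd_id.
rewrite [X in _ + X](reindex_inj (inv_inj flK)) /= -big_split /=; apply: eq_bigr => w _.
by rewrite /fl -{1}(upd_id w e); case: (w e) => //=; rewrite addrC.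
Qed.

(* Detailed balance with respect to [cond_law], integrated against two functions. *)
Lemma Qop_adj f h : \sum_w pi w * f w * Qop h w = \sum_w pi w * Qop f w * h w.
Proof.
pose G f h w e := pi w * f w *
  (open_prob w e * h (upd w e true) + (1 - open_prob w e) * h (upd w e false)).
have L f' h' : \sum_w pi w * f' w * Qop h' w = (N%:R)^-1 * \sum_e \sum_w G f' h' w e.
  rewrite exchange_big /= mulr_sumr; apply: eq_bigr => w _.
  by rewrite /Qop mulrCA mulr_sumr.
rewrite L (eq_bigr (fun w => pi w * h w * Qop f w)) ?L; last by move=> w _; ring.
congr (_ * _); apply: eq_bigr => e _.
suff sym f' h' : \sum_w G f' h' w e + \sum_w G f' h' w e =
    \sum_w (pi (upd w e true) + pi (upd w e false)) *
      (open_prob w e * f' (upd w e true) + (1 - open_prob w e) * f' (upd w e false)) *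
      (open_prob w e * h' (upd w e true) + (1 - open_prob w e) * h' (upd w e false)).
  have : \sum_w G f h w e + \sum_w G f h w e = \sum_w G h f w e + \sum_w G h f w e.
    by rewrite !sym; apply: eq_bigr => w _; ring.
  by move: (\sum_w _) (\sum_w _) => x y; lra.
rewrite (sum_flip e (fun w => G f' h' w e)); apply: eq_bigr => w _.
rewrite /G 2!open_prob_upd !upd_upd -mulrDl; congr (_ * _).
have := balance w e.
move: (pi _) (pi _) (open_prob _ _) => y x a E.
have E1 : x * a + y * a = x by rewrite -E; ring.
have E2 : x * (1 - a) + y * (1 - a) = y by rewrite E; ring.
move: (f' _) (f' _) => f2 f1.
transitivity ((x * a + y * a) * f1 + (x * (1 - a) + y * (1 - a)) * f2); last by ring.
by rewrite E1 E2.
Qed.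

Lemma iter_Qop_adj n f h :
  \sum_w pi w * f w * iter n Qop h w = \sum_w pi w * iter n Qop f w * h w.
Proof. by elim: n f => // n IH f; rewrite iterS Qop_adj IH -iterSr. Qed.

Lemma iter_Qop_inv n h : \sum_w pi w * iter n Qop h w = \sum_w pi w * h w.
Proof.
have := iter_Qop_adj n (fun=> 1) h.
rewrite (eq_bigr (fun w => pi w * iter n Qop h w)); last by move=> w _; rewrite mulr1.
by move=> ->; apply: eq_bigr => w _; rewrite iter_Qop_cst mulr1.
Qed.

End YChain.

(** * Uniqueness of the stationary law of Y *)

Section YLaw.
Variables (R : realType) (d : nat) (s : seq (zpt d)) (U : 'M[R]_d) (j : 'I_d) (p q : R).
Hypotheses (p0 : 0 < p) (p1 : p < 1) (q1 : 1 <= q) (Npos : (0 < #|{: Et s}|)%N).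
Implicit Types (w : cfg s) (e g : Et s) (f h : cfg s -> R) (F : {set Et s}).

Local Notation th := (theta U j p q).
Local Notation TB := (TBconn U j).
Local Notation N := #|{: Et s}|.
Local Notation Phi := (PhiTB U j p q).

Local Notation open_prob := (open_prob U j p q).
Local Notation Qop := (Qop U j p q).
Local Notation pi := (cond_law U j p q).

(* Maximum principle: a maximizer with the fewest open edges must be [closed_cfg],
   since closing an edge has positive probability. *)
Lemma harmonic_le h : (forall w, ~~ TB w -> h w = Qop h w) ->
  forall w, ~~ TB w -> h w <= h (@closed_cfg d s).
Proof.
move=> har w nTw.
have [m nTm maxm] : exists2 m, ~~ TB m & forall v, ~~ TB v -> h v <= h m.
  have := @arg_maxP _ _ _ (@closed_cfg d s) (fun v => ~~ TB v) h (disc_closed_cfg s U j).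
  by case=> v nTv maxv; exists v.
have mm : ~~ TB m && (h m == h m) by rewrite nTm eqxx.
have [v /andP [nTv /eqP hv] minv] :=
  @arg_minnP _ m (fun v => ~~ TB v && (h v == h m)) (fun v => #|[set e | v e]|) mm.
suff -> : (@closed_cfg d s) = v by rewrite hv maxm.
apply/ffunP => e; rewrite ffunE; apply/esym/negbTE/negP => ve.
have Z : \sum_e (open_prob v e * (h m - h (upd v e true)) +
    (1 - open_prob v e) * (h m - h (upd v e false))) = 0.
  have E : Qop h v = Qop (fun=> h m) v by rewrite (Qop_cst U j p q Npos) -hv har.
  have N0 : (N%:R : R)^-1 != 0 by rewrite invr_eq0 pnatr_eq0 -lt0n.
  move/(mulfI N0): E => E.
  rewrite (eq_bigr (fun e => (open_prob v e * h m + (1 - open_prob v e) * h m) -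
    (open_prob v e * h (upd v e true) + (1 - open_prob v e) * h (upd v e false)))).
    by rewrite sumrB E subrr.
  by move=> g _; ring.
have T0 g : 0 <= open_prob v g * (h m - h (upd v g true)) /\
    0 <= (1 - open_prob v g) * (h m - h (upd v g false)).
  have /andP [a0 a1] := open_prob_01 U j p0 p1 q1 v g; split.
    case: (eqVneq (open_prob v g) 0) => [->|ne]; first by rewrite mul0r.
    apply: mulr_ge0 => //; rewrite subr_ge0; apply: maxm; apply: (disc_open (p := p) (q := q) nTv).
    by rewrite lt_def ne.
  by apply: mulr_ge0; rewrite subr_ge0 //; apply: maxm; exact: disc_close.
have /eqP := Z; rewrite psumr_eq0; last by move=> g _; apply: addr_ge0; apply T0.
move=> /allP /(_ e (mem_index_enum _)) /=; rewrite paddr_eq0; try by apply T0.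
move=> /andP [_]; rewrite mulf_eq0 subr_eq0.
have -> : (1 == open_prob v e) = false.
  rewrite eq_sym; apply/negbTE; rewrite /open_prob; case: ifP => _; first by rewrite eq_sym oner_eq0.
  by rewrite subr_eq addrC -subr_eq subrr eq_sym gt_eqF // theta_gt0.
rewrite /= subr_eq0 => /eqP hc.
have := minv (upd v e false); rewrite disc_close // -hc eqxx => /(_ isT).
rewrite leqNgt => /negP []; apply: proper_card; apply/properP; split.
  by apply/fintype.subsetP => g; rewrite !inE updE; case: eqP.
by exists e; rewrite !inE // updE eqxx.
Qed.

Lemma harmonic_const h : (forall w, ~~ TB w -> h w = Qop h w) ->
  forall w, ~~ TB w -> h w = h (@closed_cfg d s).
Proof.
move=> har w nT; apply/le_anti; rewrite harmonic_le //=.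
rewrite -lerN2; apply: (@harmonic_le (fun w => - h w)) => // v nTv.
have E : (fun w => - h w) =1 (fun w => -1 * h w + (fun=> 0) w).
  by move=> u; rewrite mulN1r addr0.
by rewrite (Qop_ext U j p q E) Qop_lin (Qop_cst U j p q Npos) addr0 mulN1r -har.
Qed.

(** Testing invariance against point masses and using reversibility, the density of [m] with respect
    to [cond_law] is harmonic, hence constant; the total mass makes it 1. *)
Lemma Qop_unique (m : cfg s -> R) : \sum_w m w = 1 -> (forall w, TB w -> m w = 0) ->
  (forall f, \sum_w m w * f w = \sum_w m w * Qop f w) -> m =1 pi.
Proof.
move=> m1 m0 inv_m; pose g w := m w / pi w.
have mg w : m w = pi w * g w.
  case: (boolP (TB w)) => [Tw|nT]; first by rewrite m0 // /cond_law Tw mul0r.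
  by rewrite /g mulrCA divff ?mulr1 // gt_eqF ?(cond_law_gt0 p0 p1 q1).
have har w : ~~ TB w -> g w = Qop g w.
  move=> nT; have := inv_m (fun v => (v == w)%:R).
  rewrite (eq_bigr (fun v => pi v * g v * (v == w)%:R)); last by move=> v _; rewrite mg.
  rewrite [RHS](eq_bigr (fun v => pi v * g v * Qop (fun v => (v == w)%:R) v)); last first.
    by move=> v _; rewrite mg.
  rewrite (Qop_adj U j p0 p1 q1).
  rewrite (bigD1 w) //= big1 ?addr0; last by move=> v /negbTE ->; rewrite mulr0.
  rewrite [RHS](bigD1 w) //= [in RHS]big1 ?addr0; last by move=> v /negbTE ->; rewrite mulr0.
  by rewrite eqxx !mulr1; apply: mulfI; rewrite gt_eqF ?(cond_law_gt0 p0 p1 q1).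
have gc := harmonic_const har.
have g1 : g (@closed_cfg d s) = 1.
  rewrite -m1 (eq_bigr (fun w => pi w * g (@closed_cfg d s))); last first.
    move=> w _; rewrite mg; case: (boolP (TB w)) => [Tw|/gc -> //].
    by rewrite /cond_law Tw !mul0r.
  by rewrite -mulr_suml (sum_cond_law s U j p0 p1 q1) mul1r.
move=> w; rewrite mg; case: (boolP (TB w)) => [Tw|/gc ->]; first by rewrite /cond_law Tw mul0r.
by rewrite g1 mulr1.
Qed.

End YLaw.

(** * Peierls estimates for sets of closed edges *)

Section YBounds.
Variables (R : realType) (d : nat) (s : seq (zpt d)) (U : 'M[R]_d) (j : 'I_d) (p q : R).
Hypotheses (p0 : 0 < p) (p1 : p < 1) (q1 : 1 <= q) (Npos : (0 < #|{: Et s}|)%N).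
Implicit Types (w : cfg s) (e g : Et s) (f h : cfg s -> R) (F : {set Et s}).

Local Notation th := (theta U j p q).
Local Notation TB := (TBconn U j).
Local Notation N := #|{: Et s}|.
Local Notation Phi := (PhiTB U j p q).

Local Notation open_prob := (open_prob U j p q).
Local Notation Qop := (Qop U j p q).
Local Notation pi := (cond_law U j p q).

Definition all_closed F w : bool := [forall e in F, ~~ w e].

Lemma all_closedP F w : reflect (forall e, e \in F -> ~~ w e) (all_closed F w).
Proof. exact: forall_inP. Qed.

Lemma Phi_upd_le w e : Phi (upd w e false) <= eps p q * Phi (upd w e true).
Proof.
rewrite (PhiTB_upd U j q p0) ler_pM2r ?PhiTB_gt0 // /eps ler_pM2l ?oddsc_gt0 //.
by case: (linked _ _ _ _); rewrite /= ?expr0 ?expr1.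
Qed.

Lemma Phi_open_all F w : all_closed F w ->
  Phi w <= eps p q ^+ #|F| * Phi (open_all w [in F]).
Proof.
move=> /all_closedP; rewrite cardE.
have -> : open_all w [in F] = foldr (fun e v => upd v e true) w (enum F).
  apply/ffunP => g; rewrite ffunE -(mem_enum F).
  elim: (enum F) => //= e l IH; rewrite updE !inE -IH.
  by case: eqP.
move=> cl; have {}cl : forall e, e \in enum F -> ~~ w e by move=> e; rewrite mem_enum; apply: cl.
elim: (enum F) (enum_uniq F) cl => [|e l IH] /=; first by rewrite mul1r.
move=> /andP [el ul] cl; have {}IH := IH ul (fun g gl => cl g (mem_behead (s := e :: l) gl)).
apply: le_trans IH _; set v := foldr _ _ _.
have ve : v e = false.
  have -> : v e = w e.
    rewrite /v; elim: l el {ul cl v} => //= g l IH; rewrite inE negb_or => /andP [ge el].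
    by rewrite updE (negbTE ge) IH.
  by apply/negbTE/cl; rewrite mem_head.
rewrite exprSr -mulrA ler_pM2l ?exprn_gt0 ?(eps_gt0 p0 p1 q1) //.
by rewrite -{1}(upd_id v e) ve Phi_upd_le.
Qed.

(** Opening all of [F] is injective on the configurations closed on [F], and each opened edge gains
    a factor at least [eps^-1]; the images have total mass at most 1. *)
Lemma cond_law_closed F : \sum_w pi w * (all_closed F w && ~~ TB (open_all w [in F]))%:R
  <= eps p q ^+ #|F|.
Proof.
apply: (@le_trans _ _ (\sum_(w | all_closed F w) eps p q ^+ #|F| * pi (open_all w [in F]))).
  rewrite [leRHS]big_mkcond /=; apply: ler_sum => w _.
  have e0 : 0 <= eps p q ^+ #|F| by rewrite exprn_ge0 // ltW // (eps_gt0 p0 p1 q1).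
  case: ifP => [cl|_]; last by rewrite mulr0.
  case: (boolP (TB _)) => nT /=; first by rewrite mulr0 mulr_ge0 ?(cond_law_ge0 U j p0 p1 q1).
  rewrite mulr1 {2}/cond_law (negbTE nT) mulrA /cond_law; case: ifP => _.
    apply: divr_ge0; last exact/ltW/(Zdisc_gt0 s U j p0 p1 q1).
    by apply: mulr_ge0 => //; exact/ltW/(PhiTB_gt0 U j p0 p1 q1).
  by rewrite ler_pM2r ?invr_gt0 ?(Zdisc_gt0 s U j p0 p1 q1) //; exact: Phi_open_all.
rewrite -mulr_sumr; apply: ler_piMr; first by rewrite exprn_ge0 // ltW // (eps_gt0 p0 p1 q1).
pose A := [set w | all_closed F w].
have inj : {in A &, injective (fun w => open_all w [in F])}.
  move=> w w'; rewrite !inE => /all_closedP c /all_closedP c' /ffunP E; apply/ffunP => e.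
  have := E e; rewrite !ffunE /=; case: (boolP (e \in F)) => //= eF _.
  by rewrite (negbTE (c e eF)) (negbTE (c' e eF)).
rewrite (eq_bigl (fun w => w \in A)); last by move=> w; rewrite inE.
rewrite -(big_imset pi inj) /= -(sum_cond_law s U j p0 p1 q1) big_mkcond /=.
by apply: ler_sum => w _; case: ifP => // _; exact: (cond_law_ge0 U j p0 p1 q1).
Qed.

Lemma cond_law_calm_closed ctr r F : (forall g, g \in F -> inbox ctr r (base g)) ->
  \sum_w pi w * (calm U j ctr r.+1 w && all_closed F w)%:R <= eps p q ^+ #|F|.
Proof.
move=> Fin; apply: le_trans (cond_law_closed F); apply: ler_sum => w _.
case: (boolP (TB w)) => [Tw|nT]; first by rewrite /cond_law Tw !mul0r.
rewrite ler_wpM2l ?(cond_law_ge0 U j p0 p1 q1) // ler_nat; case: (boolP (_ && _)) => // /andP [cw ->] /=.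
by rewrite lt0b; exact: (calm_openable nT cw).
Qed.

(* An open edge is not pivotal, so it can only be closed by [u < theta]. *)
Lemma Qop_closed F w : ~~ TB w -> Qop (fun w => (all_closed F w)%:R) w <=
  (all_closed F w)%:R + (N%:R)^-1 * \sum_(e in F) eps p q * (all_closed (F :\ e) w)%:R.
Proof.
move=> nT.
have S0 : 0 <= (N%:R)^-1 * \sum_(e in F) eps p q * (all_closed (F :\ e) w)%:R.
  rewrite mulr_ge0 ?invr_ge0 ?ler0n // sumr_ge0 // => e _.
  by rewrite mulr_ge0 ?ler0n // ltW // (eps_gt0 p0 p1 q1).
case: (boolP (all_closed F w)) => [_|ncl].
  apply: (@le_trans _ _ 1); last by rewrite lerDl.
  rewrite -[leRHS](Qop_cst U j p q Npos 1 w); apply: (Qop_le p0 p1 q1) => // v _.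
  by case: (all_closed _ _).
rewrite add0r /Qop ler_wpM2l ?invr_ge0 ?ler0n // [leRHS]big_mkcond; apply: ler_sum => e _ /=.
have c1 : all_closed F (upd w e true) = false.
  apply/negP => /all_closedP cl; case/negP: ncl; apply/all_closedP => g gF.
  by have := cl g gF; rewrite updE; case: eqP.
rewrite c1 mulr0 add0r.
case: (boolP (all_closed F (upd w e false))) => [/all_closedP cl|_]; last first.
  by rewrite mulr0; case: ifP => // _; rewrite mulr_ge0 ?ler0n // ltW // (eps_gt0 p0 p1 q1).
have eF : e \in F.
  apply: contraNT ncl => eF; apply/all_closedP => g gF; have := cl g gF.
  by rewrite updE; case: eqP => // E; rewrite -E gF in eF.
have clD : all_closed (F :\ e) w.
  apply/all_closedP => g; rewrite !inE => /andP [ge gF]; have := cl g gF.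
  by rewrite updE (negbTE ge).
have we : w e.
  apply: contraNT ncl => nwe; apply/all_closedP => g gF; have := cl g gF.
  by rewrite updE; case: eqP => // ->.
rewrite eF clD mulr1 /open_prob /pivotal.
have -> : upd w e true = w by rewrite -{2}(upd_id w e) we.
by rewrite (negbTE nT) mulr1 opprB addrCA subrr addr0 (theta_le_eps U j p0 p1 q1).
Qed.

(** The first two terms of the binomial expansion; for [n = 0] the truncated exponent is multiplied
    by 0. *)
Lemma exprD_ge (x y : R) n : 0 <= x -> 0 <= y ->
  x ^+ n + n%:R * (y * x ^+ n.-1) <= (x + y) ^+ n.
Proof.
move=> x0 y0; elim: n => [|n IH]; first by rewrite mul0r addr0 !expr0.
have xn : 0 <= x ^+ n by rewrite exprn_ge0.
rewrite [leRHS]exprSr; apply: (@le_trans _ _ ((x ^+ n + n%:R * (y * x ^+ n.-1)) * (x + y))); last first.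
  by rewrite ler_wpM2r // addr_ge0.
rewrite mulrDr !mulrDl exprSr /= -natr1.
have -> : n%:R * (y * x ^+ n.-1) * x = n%:R * (y * x ^+ n).
  by case: n {IH xn} => [|n]; rewrite ?mul0r //= exprSr; ring.
have : 0 <= n%:R * (y * x ^+ n.-1) * y by rewrite !mulr_ge0 // exprn_ge0.
lra.
Qed.

(** Look at the last step: either [F] was already closed, or its one missing edge closes, at cost
    [eps / N]. The two contributions are the first terms of the power [(x + eps / N) ^ #|F|], with
    [x] the factor reached one step earlier; so the cost per edge grows linearly in time. Calm is
    required at time 0 only. *)
Lemma calm_closed_later ctr r k F : (forall g, g \in F -> inbox ctr r (base g)) ->
  \sum_w pi w * (calm U j ctr r.+1 w)%:R * iter k Qop (fun w => (all_closed F w)%:R) w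
    <= (eps p q * (1 + k%:R / N%:R)) ^+ #|F|.
Proof.
have e0 : 0 < eps p q by exact: (eps_gt0 p0 p1 q1).
elim: k F => [|k IH] F Fin.
  rewrite mul0r addr0 mulr1; apply: le_trans (cond_law_calm_closed Fin).
  by apply: ler_sum => w _ /=; rewrite -mulrA -natrM mulnb.
set lam := eps p q * (1 + k%:R / N%:R) in IH *.
have l0 : 0 <= lam by rewrite mulr_ge0 ?ltW // addr_ge0 // mulr_ge0 ?invr_ge0 ?ler0n.
have -> : eps p q * (1 + k.+1%:R / N%:R) = lam + eps p q / N%:R.
  by rewrite /lam -natr1; ring.
apply: le_trans (exprD_ge #|F| l0 _); last by rewrite mulr_ge0 ?invr_ge0 ?ler0n // ltW.
pose c w : R := pi w * (calm U j ctr r.+1 w)%:R.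
apply: (@le_trans _ _ (\sum_w c w * iter k Qop (fun w => (eps p q / N%:R) *
    (\sum_(e in F) (all_closed (F :\ e) w)%:R) + (all_closed F w)%:R) w)).
  apply: ler_sum => w _; case: (boolP (TB w)) => [Tw|nT]; first by rewrite /c /cond_law Tw !mul0r.
  rewrite ler_wpM2l ?mulr_ge0 ?(cond_law_ge0 U j p0 p1 q1) ?ler0n // iterSr; apply: (iter_Qop_le p0 p1 q1) => // v nTv.
  apply: le_trans (Qop_closed F nTv) _; rewrite addrC lerD2r -mulr_sumr mulrA.
  by rewrite [_^-1 * _]mulrC.
rewrite (eq_bigr (fun w => c w * iter k Qop (fun w => (all_closed F w)%:R) w +
    eps p q / N%:R * \sum_(e in F) c w * iter k Qop (fun w => (all_closed (F :\ e) w)%:R) w)); last first.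
  move=> w _; rewrite iter_Qop_lin mulrDr addrC; congr (_ + _).
  rewrite mulrCA; congr (_ * _).
  rewrite -mulr_sumr; congr (_ * _).
  have E : (fun w => \sum_(e in F) (all_closed (F :\ e) w)%:R : R) =1
      (fun w => \sum_(e <- enum F) (all_closed (F :\ e) w)%:R) by move=> v; rewrite big_enum.
  rewrite (iter_Qop_ext U j p q k E).
  rewrite (iter_Qop_sum U j p q Npos); exact: big_enum.
rewrite big_split /= -mulr_sumr exchange_big /=; apply: lerD; first exact: IH.
rewrite mulrCA; apply: ler_wpM2l.
  by rewrite mulr_ge0 ?invr_ge0 ?ler0n // ltW.
rewrite mulr_natl -sumr_const; apply: ler_sum => e eF.
rewrite (cardsD1 e F) eF /=; apply: IH => g; rewrite !inE => /andP [_]; exact: Fin.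
Qed.

End YBounds.

(** * Loss of calm over time *)

Section Escape.
Variables (R : realType) (d : nat) (s : seq (zpt d)) (U : 'M[R]_d) (j : 'I_d) (p q : R).
Hypotheses (p0 : 0 < p) (p1 : p < 1) (q1 : 1 <= q) (Npos : (0 < #|{: Et s}|)%N).
Implicit Types (w : cfg s) (e f g : Et s) (F : {set Et s}).

Local Notation th := (theta U j p q).
Local Notation TB := (TBconn U j).
Local Notation N := #|{: Et s}|.
Local Notation Phi := (PhiTB U j p q).

Local Notation open_prob := (open_prob U j p q).
Local Notation Qop := (Qop U j p q).
Local Notation pi := (cond_law U j p q).


Lemma indicator_le_sum (I : Type) (r : seq I) (P : pred I) (b : bool) :
  (b -> has P r) -> (b%:R : R) <= \sum_(i <- r) (P i)%:R.
Proof.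
case: b => [/(_ isT)|_]; last by apply: sumr_ge0 => i _; rewrite ler0n.
elim: r => //= i r IH; rewrite big_cons => /orP [->|/IH le].
  by rewrite lerDl sumr_ge0 // => k _; rewrite ler0n.
by apply: le_trans le _; rewrite lerDr ler0n.
Qed.

Lemma card_set_uniq (T : finType) (l : seq T) : uniq l -> #|[set x in l]| = size l.
Proof. by move=> ul; rewrite cardsE; apply/card_uniqP. Qed.

Lemma sum_walks_le n (G : Et s -> seq (Et s) -> R) (c : R) : 0 <= c ->
  (forall f l, l \in walks (@eadj d s) n f -> G f l <= c) ->
  \sum_f \sum_(l <- walks (@eadj d s) n f) G f l <= N%:R * (d * 3 ^ d)%:R ^+ n * c.
Proof.
move=> c0 Gc; apply: (@le_trans _ _ (\sum_(f : Et s) (d * 3 ^ d)%:R ^+ n * c)).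
  apply: ler_sum => f _; rewrite big_seq.
  apply: (@le_trans _ _ (\sum_(l <- walks (@eadj d s) n f | l \in walks (@eadj d s) n f) c)).
    by apply: ler_sum => l; exact: Gc.
  rewrite -big_seq big_const_seq count_predT iter_addr_0 -[c *+ _]mulr_natl ler_wpM2r // -natrX ler_nat.
  exact/size_walks/eadj_deg.
by rewrite sumr_const -[_ *+ _]mulr_natl mulrA.
Qed.

Definition escape n ctr rad r : R :=
  \sum_w pi w * (calm U j ctr rad w)%:R * iter n Qop (fun v : cfg s => (~~ calm U j ctr r v)%:R) w.

(** The walk of [l.+2] closed edges given by [not_calm_walk] lies in the box that was calm at time
    0, and [k <= N] bounds the cost per edge by [2 * eps]. The remaining factors count the walks. *)
Lemma escape_short (i0 i1 : 'I_d) k ctr r l : i0 != i1 -> (k <= N)%N ->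
  (forall x, inbox ctr (r + l).+2 x -> x \in s) ->
  escape k ctr (r + l).+2 r <= N%:R * (d * 3 ^ d)%:R ^+ l.+1 * (2 * eps p q) ^+ l.+2.
Proof.
move=> i01 kN bs.
have e0 := eps_gt0 p0 p1 q1.
pose ok (x : Et s * seq (Et s)) := uniq (x.1 :: x.2) &&
  all (fun g => inbox ctr (r + l).+1 (base g)) (x.1 :: x.2).
pose ss := [seq (f, t) | f <- enum {: Et s}, t <- walks (@eadj d s) l.+1 f].
pose fs (x : Et s * seq (Et s)) : {set Et s} := [set g in x.1 :: x.2].
have sumss (G : Et s * seq (Et s) -> R) :
    \sum_(x <- ss) G x = \sum_f \sum_(t <- walks (@eadj d s) l.+1 f) G (f, t).
  by rewrite big_allpairs_dep big_enum.
pose c w : R := pi w * (calm U j ctr (r + l).+2 w)%:R.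
have c0 w : 0 <= c w by rewrite mulr_ge0 ?ler0n ?(cond_law_ge0 U j p0 p1 q1).
apply: (@le_trans _ _ (\sum_w c w * iter k Qop
    (fun v => \sum_(x <- ss) (ok x)%:R * (all_closed (fs x) v)%:R) w)).
  apply: ler_sum => w _; case: (boolP (TB w)) => [Tw|nT].
    by rewrite /c /cond_law Tw !mul0r.
  rewrite -/(c w); apply: (ler_wpM2l (c0 w)); apply: (iter_Qop_le p0 p1 q1) nT => v nTv.
  rewrite (eq_bigr (fun x => (ok x && all_closed (fs x) v)%:R)); last first.
    by move=> x _; rewrite -natrM mulnb.
  apply: indicator_le_sum => ncalm.
  have [f [t [bf tw ut /allP at_]]] := not_calm_walk i01 bs nTv ncalm.
  apply/hasP; exists (f, t).
    by apply/allpairsPdep; exists f, t; rewrite mem_enum.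
  rewrite /ok ut /=; apply/andP; split.
    apply/andP; split; first by have /and3P [] := at_ f (mem_head _ _).
    by apply/allP => g gt; have /and3P [] := at_ g (mem_behead (s := f :: t) gt).
  by apply/all_closedP => g; rewrite inE => /at_ /and3P [].
rewrite (eq_bigr (fun w => \sum_(x <- ss) (ok x)%:R *
    (c w * iter k Qop (fun v => (all_closed (fs x) v)%:R) w))); last first.
  move=> w _; rewrite (iter_Qop_sum U j p q Npos) mulr_sumr; apply: eq_bigr => x _.
  by rewrite iter_Qop_scale mulrCA.
rewrite exchange_big /= sumss; apply: sum_walks_le.
  by rewrite exprn_ge0 // mulr_ge0 // ltW.
move=> f t /walksP [st _]; rewrite -mulr_sumr.
case: (boolP (ok (f, t))) => [/andP [ut /allP at_]|_]; last first.
  by rewrite mul0r exprn_ge0 // mulr_ge0 // ltW.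
rewrite mul1r.
have Fin g : g \in fs (f, t) -> inbox ctr (r + l).+1 (base g).
  by rewrite inE => gt; exact: (at_ g gt).
apply: le_trans (calm_closed_later U j p0 p1 q1 Npos k Fin) _.
have -> : #|fs (f, t)| = l.+2.
  by rewrite /fs (card_set_uniq ut) -st.
apply: lerXn2r; rewrite ?nnegrE.
- by rewrite mulr_ge0 ?ltW // addr_ge0 // mulr_ge0 ?invr_ge0 ?ler0n.
- by rewrite mulr_ge0 ?ltW.
rewrite mulrC ler_pM2r // -[2]/(1 + 1) lerD2l.
by rewrite ler_pdivrMr ?ltr0n // mul1r ler_nat.
Qed.

(** Time is cut into blocks of at most [N] steps, each using up [l.+2] units of radius. After the
    first block either calm is lost at radius [a], or the chain starts afresh from a configuration
    calm at that radius. *)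
Lemma escape_le (i0 i1 : 'I_d) (eta : R) ctr r l : i0 != i1 ->
  (forall k a, (k <= N)%N -> (forall x, inbox ctr (a + l).+2 x -> x \in s) ->
     escape k ctr (a + l).+2 a <= eta) ->
  forall i n, (n <= i * N)%N -> (forall x, inbox ctr (r + i * l.+2) x -> x \in s) ->
  escape n ctr (r + i * l.+2) r <= i%:R * eta.
Proof.
move=> i01 short; elim=> [|i IH] n ni bs.
  have -> : n = 0%N by lia.
  rewrite mul0r addn0 /escape big1 // => w _ /=.
  by case: (calm _ _ _ _ _); rewrite ?mulr0 ?mul0r.
pose a := (r + i * l.+2)%N.
have ae : (r + i.+1 * l.+2 = (a + l).+2)%N by rewrite /a; lia.
have [k [m [kN mi nE]]] : exists k m, [/\ (k <= N)%N, (m <= i * N)%N & n = (k + m)%N].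
  case: (leqP n N) => nN; first by exists n, 0%N; rewrite addn0.
  by exists N, (n - N)%N; split=> //; lia.
rewrite ae nE in bs *; rewrite -natr1 mulrDl mul1r addrC.
pose g (v : cfg s) : R := (~~ calm U j ctr r v)%:R.
have g01 v : ~~ TB v -> iter m Qop g v <= 1.
  apply: (iter_Qop_le1 p0 p1 q1 Npos) => u _; by rewrite /g; case: (calm _ _ _ _ _).
have g0 v : ~~ TB v -> 0 <= iter m Qop g v.
  by apply: (iter_Qop_ge0 p0 p1 q1 Npos) => u _; exact: ler0n.
apply: (@le_trans _ _ (escape k ctr (a + l).+2 a + escape m ctr a r)); last first.
  apply: lerD; first exact: short.
  by apply: IH => // x bx; apply: bs; apply: inbox_le bx; lia.
pose h (v : cfg s) : R := (calm U j ctr a v)%:R * iter m Qop g v.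
rewrite [X in _ + X](_ : _ = \sum_w pi w * h w); last first.
  by apply: eq_bigr => w _; rewrite /h mulrA.
(* Stationarity lets the escape over the last [m] steps start at time [k] instead of time 0. *)
rewrite -(iter_Qop_inv U j p0 p1 q1 Npos k h) -big_split /=; apply: ler_sum => w _.
case: (boolP (TB w)) => [Tw|nT]; first by rewrite /cond_law Tw !mul0r addr0.
have pw : 0 <= pi w := cond_law_ge0 U j p0 p1 q1 w.
have h0 : 0 <= iter k Qop h w.
  apply: (iter_Qop_ge0 p0 p1 q1 Npos) => // v nTv.
  by rewrite mulr_ge0 ?ler0n // g0.
rewrite iterD -!/(iter _ _ _).
case: (calm _ _ _ _ w); last by rewrite mulr0 !mul0r add0r mulr_ge0.
rewrite mulr1 -mulrDr; apply: ler_wpM2l => //.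
rewrite -[X in X + _]mul1r -iter_Qop_lin; apply: (iter_Qop_le p0 p1 q1) => // v nTv.
rewrite /h; case: (calm _ _ _ _ v); rewrite /= ?mulr0 ?add0r ?mul1r //.
by rewrite mul0r addr0 g01.
Qed.

(* By reversibility the escape estimates, proved forward in time, also control
   how the pivotal edges came close before a calm time. *)
Lemma escape_rev n ctr rad r :
  \sum_w pi w * (~~ calm U j ctr r w)%:R * iter n Qop (fun v : cfg s => (calm U j ctr rad v)%:R) w
  = escape n ctr rad r.
Proof.
rewrite (iter_Qop_adj U j p0 p1 q1); apply: eq_bigr => w _.
by rewrite mulrAC.
Qed.

End Escape.

(** * The coupled chain *)

Section PairChain.
Variables (R : realType) (d : nat) (s : seq (zpt d)) (U : 'M[R]_d) (j : 'I_d) (p q : R).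
Hypotheses (p0 : 0 < p) (p1 : p < 1) (q1 : 1 <= q) (Npos : (0 < #|{: Et s}|)%N).
Variable mu : cfg s * cfg s -> R.
Hypothesis stat : stationary U j p q mu.
Implicit Types (st : cfg s * cfg s) (w : cfg s) (e f g : Et s) (F : {set Et s}).

Local Notation th := (theta U j p q).
Local Notation TB := (TBconn U j).
Local Notation N := #|{: Et s}|.
Local Notation Qop := (Qop U j p q).
Local Notation pi := (cond_law U j p q).
Local Notation K := (Defs.kernel U j p q).
Local Notation calm := (calm U j).

Definition Kop (G : cfg s * cfg s -> R) st : R :=
  (N%:R)^-1 * \sum_e \sum_b flip_mass U j p q st e b * G (upd st.1 e b.1, upd st.2 e b.2).

Lemma sum_kernel (nu G : cfg s * cfg s -> R) :
  \sum_st' (\sum_st nu st * K st st') * G st' = \sum_st nu st * Kop G st.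
Proof.
under eq_bigr do rewrite mulr_suml; rewrite exchange_big /=; apply: eq_bigr => st _.
by rewrite /Kop -kernelE mulr_sumr; apply: eq_bigr => st' _; rewrite mulrA.
Qed.

Lemma mu_inv (G : cfg s * cfg s -> R) : \sum_st mu st * G st = \sum_st mu st * Kop G st.
Proof.
case: stat => _ _ _ mu_eq; rewrite -sum_kernel; apply: eq_bigr => st _.
by rewrite [in LHS]mu_eq.
Qed.

Lemma sum_bool2 (G : bool * bool -> R) :
  \sum_b G b = (G (true, true) + G (false, true)) + (G (true, false) + G (false, false)).
Proof.
rewrite (eq_bigr (fun b => G (b.1, b.2))); last by case.
by rewrite -(pair_big xpredT xpredT (fun b b' => G (b, b'))) /= !big_bool /=; ring.
Qed.

Lemma flip_mass_ge0 st e b : 0 <= flip_mass U j p q st e b.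
Proof. exact: split_mass_ge0. Qed.

Lemma flip_mass_open st e : flip_mass U j p q st e (true, true) +
  flip_mass U j p q st e (false, true) = open_prob U j p q st.2 e.
Proof. exact/split_mass_open/theta_01. Qed.

Lemma flip_mass_closed st e : flip_mass U j p q st e (true, false) +
  flip_mass U j p q st e (false, false) = 1 - open_prob U j p q st.2 e.
Proof.
rewrite /flip_mass split_mass_closed; last exact: theta_01.
by rewrite /open_prob; case: ifP => _; rewrite ?subr0 // opprB addrCA subrr addr0.
Qed.

Lemma Kop_snd (G : cfg s -> R) st : Kop (fun st => G st.2) st = Qop G st.2.
Proof.
rewrite /Kop /Qop; congr (_ * _); apply: eq_bigr => e _.
by rewrite sum_bool2 /= -!mulrDl flip_mass_open flip_mass_closed.
Qed.

Lemma Kop_ext (G H : cfg s * cfg s -> R) : G =1 H -> Kop G =1 Kop H.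
Proof.
move=> E st; rewrite /Kop; congr (_ * _); apply: eq_bigr => e _; apply: eq_bigr => b _.
by rewrite E.
Qed.

Lemma Kop_le (G H : cfg s * cfg s -> R) : (forall st, G st <= H st) ->
  forall st, Kop G st <= Kop H st.
Proof.
move=> GH st; apply: ler_wpM2l; first by rewrite invr_ge0 ler0n.
by apply: ler_sum => e _; apply: ler_sum => b _; apply: ler_wpM2l; rewrite ?flip_mass_ge0.
Qed.

Lemma iter_Kop_snd n (G : cfg s -> R) st :
  iter n Kop (fun st => G st.2) st = iter n Qop G st.2.
Proof. by elim: n st => // n IH st; rewrite !iterS (Kop_ext IH) Kop_snd. Qed.

Lemma iter_Kop_le n (G H : cfg s * cfg s -> R) : (forall st, G st <= H st) ->
  forall st, iter n Kop G st <= iter n Kop H st.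
Proof. by move=> GH; elim: n => // n IH st; apply: Kop_le. Qed.

Lemma Kop_ge0 (G : cfg s * cfg s -> R) : (forall st, 0 <= G st) -> forall st, 0 <= Kop G st.
Proof.
move=> G0 st; rewrite mulr_ge0 ?invr_ge0 ?ler0n //; apply: sumr_ge0 => e _.
by apply: sumr_ge0 => b _; rewrite mulr_ge0 ?flip_mass_ge0.
Qed.

Lemma mu_ge0 st : 0 <= mu st. Proof. by case: stat. Qed.

(** Y evolves on its own, so the second marginal of [mu] is invariant under [Qop], and [Qop_unique]
    identifies it. *)
Lemma sum_mu_snd (G : cfg s -> R) : \sum_st mu st * G st.2 = \sum_w pi w * G w.
Proof.
pose m w := \sum_x mu (x, w).
have E (H : cfg s -> R) : \sum_st mu st * H st.2 = \sum_w m w * H w.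
  rewrite (eq_bigr (fun st => mu (st.1, st.2) * H st.2)); last by case.
  rewrite -(pair_big xpredT xpredT (fun x w => mu (x, w) * H w)) /= exchange_big /=.
  by apply: eq_bigr => w _; rewrite mulr_suml.
case: stat => _ mu1 mu0 _.
rewrite E; apply: eq_bigr => w _; congr (_ * _); move: w; apply: (Qop_unique p0 p1 q1 Npos).
- rewrite -mu1 [RHS](eq_bigr (fun st => mu st * (fun=> 1) st.2)); last by move=> st _; rewrite mulr1.
  by rewrite (E (fun=> 1)); apply: eq_bigr => w _; rewrite mulr1.
- move=> w Tw; rewrite /m big1 // => x _; apply: mu0.
  by rewrite /state_space /= Tw.
- by move=> H; rewrite -!E mu_inv; apply: eq_bigr => st _; rewrite Kop_snd.
Qed.

Section Killed.
Variables (ctr : zpt d) (rad : nat).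

(* The law of the chain restricted to trajectories that have been calm so far. *)
Fixpoint killed k st' : R :=
  if k is k'.+1 then (calm ctr rad st'.2)%:R * \sum_st killed k' st * K st st'
  else mu st' * (calm ctr rad st'.2)%:R.

Lemma kernel_ge0 st st' : 0 <= K st st'.
Proof.
rewrite /Defs.kernel mulr_ge0 ?invr_ge0 ?ler0n //; apply: sumr_ge0 => e _.
exact/fine_ge0/measure_ge0.
Qed.

Lemma killed_bounds k st : 0 <= killed k st <= mu st * (calm ctr rad st.2)%:R.
Proof.
elim: k st => [|k IH] st /=; first by rewrite lexx mulr_ge0 ?mu_ge0 ?ler0n.
rewrite mulr_ge0 ?ler0n //=; last first.
  by apply: sumr_ge0 => st' _; have /andP [h0 _] := IH st'; rewrite mulr_ge0 ?kernel_ge0.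
rewrite mulrC ler_wpM2r ?ler0n //; case: stat => _ _ _ ->.
apply: ler_sum => st' _; apply: ler_wpM2r; first exact: kernel_ge0.
have /andP [_ h1] := IH st'; apply: le_trans h1 _.
by rewrite ler_piMr ?mu_ge0 //; case: (calm _ _ _).
Qed.

Lemma killed_ge0 k st : 0 <= killed k st.
Proof. by have /andP [] := killed_bounds k st. Qed.

Lemma killed_le_mu k st : killed k st <= mu st.
Proof.
have /andP [_ h] := killed_bounds k st; apply: le_trans h _.
by rewrite ler_piMr ?mu_ge0 //; case: (calm _ _ _).
Qed.

Lemma killed_neq0 k st : killed k st != 0 -> calm ctr rad st.2 /\ state_space U j st.
Proof.
move=> ne; have /andP [h0 h] := killed_bounds k st.
have lt0 : 0 < mu st * (calm ctr rad st.2)%:R.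
  by apply: lt_le_trans h; rewrite lt_def ne.
split; first by move: lt0; case: (calm _ _ _); rewrite // mulr0 ltxx.
apply: contraTT lt0 => ss; case: stat => _ _ /(_ _ ss) -> _.
by rewrite mul0r ltxx.
Qed.

(** A union bound over the times at which calm fails, [i] counting the steps back from the present.
    By stationarity the chain has law [mu] at each of these times. *)
Lemma killed_split k (G : cfg s * cfg s -> R) : (forall st, 0 <= G st) ->
  \sum_st mu st * G st <= \sum_st killed k st * G st +
    \sum_(i < k.+1) \sum_st mu st * (~~ calm ctr rad st.2)%:R * iter i Kop G st.
Proof.
elim: k G => [|k IH] G G0.
  rewrite big_ord1 /= -big_split /=; apply: ler_sum => st _.
  by case: (calm _ _ _); rewrite /= ?mulr1 ?mulr0 ?mul0r ?addr0 ?add0r.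
rewrite mu_inv; apply: le_trans (IH _ (Kop_ge0 G0)) _.
rewrite [X in _ <= _ + X]big_ord_recl [leRHS]addrA /=; apply: lerD; last first.
  apply: ler_sum => i _; apply: ler_sum => st _.
  by rewrite -iterSr.
rewrite -sum_kernel -big_split /=; apply: ler_sum => st _.
rewrite -mulrDl; apply: ler_wpM2r => //.
have le : \sum_st0 killed k st0 * K st0 st <= mu st.
  case: stat => _ _ _ ->; apply: ler_sum => st' _.
  by rewrite ler_wpM2r ?kernel_ge0 ?killed_le_mu.
by case: (calm _ _ _); rewrite /= ?mul1r ?mulr0 ?addr0 ?mul0r ?add0r ?mulr1.
Qed.

(** As X dominates Y on the state space, a discrepancy at [f] is necessarily open in X and closed in
    Y. *)
Definition ind F f st : bool := [&& all_closed F st.2, st.1 f & ~~ st.2 f].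

Lemma killed_step k F f : \sum_st killed k.+1 st * (ind F f st)%:R <=
  \sum_st killed k st * Kop (fun st => (ind F f st)%:R) st.
Proof.
rewrite -sum_kernel; apply: ler_sum => st _; apply: ler_wpM2r; first by rewrite ler0n.
rewrite /= ler_piMl //; last by case: (calm _ _ _).
by apply: sumr_ge0 => st' _; rewrite mulr_ge0 ?killed_ge0 ?kernel_ge0.
Qed.

Lemma killed_closed k F : (forall g, g \in F -> inbox ctr rad.-1 (base g)) -> (0 < rad)%N ->
  \sum_st killed k st * (all_closed F st.2)%:R <= eps p q ^+ #|F|.
Proof.
move=> Fin r0.
apply: (@le_trans _ _ (\sum_st mu st * (calm ctr rad.-1.+1 st.2 && all_closed F st.2)%:R)).
  apply: ler_sum => st _; rewrite prednK // -mulnb natrM mulrA.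
  by apply: ler_wpM2r; rewrite ?ler0n //; have /andP [] := killed_bounds k st.
rewrite (sum_mu_snd (fun w => (calm ctr rad.-1.+1 w && all_closed F w)%:R)).
exact: cond_law_calm_closed.
Qed.

End Killed.

Lemma calm_not_pivotal ctr r w g : ~~ TB w -> calm ctr r.+1 w -> inbox ctr r (base g) ->
  ~~ pivotal U j w g.
Proof.
move=> nT cw bg; rewrite /pivotal.
have -> : upd w g true = open_all w (pred1 g).
  by apply/ffunP => e; rewrite !ffunE /=; case: eqP.
by apply: calm_openable nT cw _ => e /eqP ->.
Qed.

(** The three terms are the possible positions of the updated edge. Outside [F] nothing changes. At
    another edge of [F], the rest of [F] was closed and the discrepancy was present; as no edge of
    [F] is pivotal, closing costs [eps]. At [f] itself, X opens while Y closes, which requires a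
    smaller threshold for X and therefore an X-link without a Y-link. *)
Lemma Kop_ind ctr r F f st : ~~ TB st.2 -> calm ctr r.+1 st.2 ->
  (forall g, g \in F -> inbox ctr r (base g)) -> f \in F ->
  Kop (fun st => (ind F f st)%:R) st <= (N%:R)^-1 *
   ((#|~: F|)%:R * (ind F f st)%:R + \sum_(e in F :\ f) eps p q * (ind (F :\ e) f st)%:R +
    eps p q * ([&& all_closed (F :\ f) st.2, linked U j st.1 f & ~~ linked U j st.2 f])%:R).
Proof.
move=> nT cs Fin fF; apply: ler_wpM2l; first by rewrite invr_ge0 ler0n.
have e0 : 0 < eps p q by exact: eps_gt0.
have nopiv e : e \in F -> open_prob U j p q st.2 e = 1 - th st.2 e.
  by move=> eF; rewrite /open_prob (negbTE (calm_not_pivotal nT cs (Fin e eF))).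
have closedD e : all_closed F (upd st.2 e false) -> all_closed (F :\ e) st.2.
  move=> /all_closedP cl; apply/all_closedP => g; rewrite !inE => /andP [ge gF].
  by have := cl g gF; rewrite updE (negbTE ge).
have opened e : e \in F -> all_closed F (upd st.2 e true) = false.
  by move=> eF; apply/negP => /all_closedP /(_ e eF); rewrite updE eqxx.
have mixed e : e \in F -> flip_mass U j p q st e (true, false) <= eps p q.
  move=> eF; apply: le_trans (theta_le_eps U j p0 p1 q1 st.2 e).
  have := flip_mass_closed st e; rewrite nopiv // opprB addrCA subrr addr0 => <-.
  by rewrite lerDl flip_mass_ge0.
rewrite (bigID (mem F)) /= addrC -addrA; apply: lerD.
  rewrite mulr_natl -sumr_const; rewrite (eq_bigl (fun e => e \in ~: F)); last by move=> e; rewrite inE.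
  apply: ler_sum => e; rewrite inE => eF.
  have ef : (f == e) = false by apply/negbTE; apply: contraNneq eF => <-.
  have E b : ind F f (upd st.1 e b.1, upd st.2 e b.2) = ind F f st.
    rewrite /ind /= !updE ef; congr (_ && _); apply/all_closedP/all_closedP => cl g gF;
    have := cl g gF; rewrite updE; case: eqP => // ge; by rewrite -ge gF in eF.
  rewrite sum_bool2 !E -!mulrDl flip_mass_open flip_mass_closed.
  by rewrite addrCA subrr addr0 mul1r.
rewrite (bigD1 f) //= addrC; apply: lerD.
  rewrite (eq_bigl (fun e => e \in F :\ f)); last by move=> e; rewrite !inE andbC.
  apply: ler_sum => e; rewrite !inE => /andP [ef eF].
  have fe : (f == e) = false by rewrite eq_sym (negbTE ef).
  rewrite sum_bool2 /= /ind /= !opened //= !updE fe !mulr0 !add0r -mulrDl flip_mass_closed nopiv //.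
  rewrite opprB addrCA subrr addr0; apply: ler_pM.
  - exact/ltW/theta_gt0.
  - exact: ler0n.
  - exact: theta_le_eps.
  by case: (boolP (all_closed F _)) => // /closedD ->.
rewrite sum_bool2 /= /ind /= !opened //= !updE eqxx /= !andbF !andbT !mulr0 !addr0 !add0r.
case: (boolP (all_closed F _)) => [/closedD ->|_]; last by rewrite mulr0 mulr_ge0 ?ler0n // ltW.
rewrite /= mulr1; case: (leP (th st.2 f) (th st.1 f)) => [le|lt].
  rewrite /flip_mass /= (negbTE (calm_not_pivotal nT cs (Fin f fF))) split_mass_mixed //.
  by rewrite mulr_ge0 ?ler0n // ltW.
have /andP [-> ->] := theta_lt_linked p0 p1 q1 lt.
by rewrite mulr1 mixed.
Qed.

End PairChain.

(** * Decay of discrepancies in a box that stays calm *)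

Lemma last_exit (T : eqType) (r : rel T) (A : pred T) x l : path r x l ->
  all (predC A) l \/ exists h t, [/\ A h, path r h t, last h t = last x l,
    all (predC A) t & subseq t l].
Proof.
elim: l x => [|y l IH] x /=; first by left.
move=> /andP [_ pl]; have [nA|[h [t [Ah pt lt nt st]]]] := IH _ pl; last first.
  by right; exists h, t; split=> //; apply: subseq_trans st (subseq_cons _ _).
case: (boolP (A y)) => Ay; last by left; apply/andP; split.
by right; exists y, l; split=> //; exact: subseq_cons.
Qed.

Lemma sum_ge_mem (R : realType) (I : eqType) (r : seq I) (G : I -> R) i :
  (forall k, 0 <= G k) -> i \in r -> G i <= \sum_(k <- r) G k.
Proof.
move=> G0 ir; rewrite (big_rem i ir) /= lerDl.
by apply: sumr_ge0 => k _; exact: G0.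
Qed.

Section Discrepancy.
Variables (R : realType) (d : nat) (s : seq (zpt d)) (U : 'M[R]_d) (j : 'I_d) (p q : R).
Hypotheses (p0 : 0 < p) (p1 : p < 1) (q1 : 1 <= q) (Npos : (0 < #|{: Et s}|)%N).
Variable mu : cfg s * cfg s -> R.
Hypothesis stat : stationary U j p q mu.
Variables (i0 i1 : 'I_d) (i01 : i0 != i1) (ctr : zpt d) (rho : nat).
Hypothesis box_s : forall x, inbox ctr rho.+2 x -> x \in s.
Implicit Types (st : cfg s * cfg s) (w : cfg s) (e f g h : Et s) (F : {set Et s}).
Implicit Type t : seq (Et s).

Local Notation TB := (TBconn U j).
Local Notation N := #|{: Et s}|.
Local Notation Delta := ((d * 3 ^ d)%:R : R).
Local Notation walks := (walks (@eadj d s)).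

Definition okw F t : bool :=
  uniq t && all (fun g => (g \notin F) && inbox ctr rho.+1 (base g)) t.
(** [f] has just been updated, so its earlier state is unknown: it is dropped, and the walk takes
    its place. *)
Definition ext F f t : {set Et s} := (F :\ f) :|: [set g in t].

Lemma card_ext F f t : f \in F -> okw F t -> #|ext F f t| = (#|F|.-1 + size t)%N.
Proof.
move=> fF /andP [ut /allP tF]; rewrite /ext cardsU (card_set_uniq ut).
have -> : (F :\ f) :&: [set g in t] = finset.set0.
  apply/setP => g; rewrite !inE; apply/negP => /andP [/andP [_ gF] gt].
  by have := tF g gt; rewrite gF.
by rewrite cards0 subn0 (cardsD1 f F) fF.
Qed.

Lemma path_inbox_mem h t g : path (@eadj d s) h t -> g \in t ->
  inbox (base h) (size t) (base g).
Proof.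
move=> + gt; case/splitPr: gt => t1 t2; rewrite -cat_rcons cat_path => /andP [/path_inbox + _].
by rewrite last_rcons; apply: inbox_le; rewrite size_cat leq_addr.
Qed.

(* A new discrepancy at [f] needs closed edges joining [F] either to another
   discrepancy or far away; only the part of the walk after its last visit of
   [F] is kept, so that its edges are new. *)
Lemma discrepancy_sum F f m st : f \in F -> (forall g, g \in F -> inbox ctr m (base g)) ->
  (m <= rho)%N ->
  ([&& all_closed (F :\ f) st.2, linked U j st.1 f & ~~ linked U j st.2 f])%:R <=
  \sum_(h in F) (\sum_(i < (rho - m).+1) \sum_(t <- walks i h)
       (okw F t && (last h t != f))%:R * (ind (ext F f t) (last h t) st)%:R +
     \sum_(t <- walks (rho - m).+1 h) (okw F t)%:R * (all_closed (ext F f t) st.2)%:R) :> R.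
Proof.
move=> fF Fin mr; set L := (rho - m).+1.
have T1 h i : 0 <= \sum_(t <- walks i h)
       (okw F t && (last h t != f))%:R * (ind (ext F f t) (last h t) st)%:R :> R.
  by apply: sumr_ge0 => t _; rewrite mulr_ge0 ?ler0n.
have T2 h : 0 <= \sum_(t <- walks L h) (okw F t)%:R * (all_closed (ext F f t) st.2)%:R :> R.
  by apply: sumr_ge0 => t _; rewrite mulr_ge0 ?ler0n.
case: (boolP [&& _, _ & _]) => [/and3P [/all_closedP clF lX lY]|_]; last first.
  by apply: sumr_ge0 => h _; rewrite addr_ge0 // sumr_ge0.
have bf := Fin f fF.
have [l [pl ul /allP cl lastl]] := discrepancy_walk i01 box_s (inbox_le mr bf) lX lY.
have [h [t [hF pt lt /allP nt st_l]]] : exists h t, [/\ h \in F, path (@eadj d s) h t,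
    last h t = last f l, all (predC (mem F)) t & subseq t l].
  (* A walk that never returns to [F] is kept whole, starting from [f]. *)
  have [nF|//] := last_exit (mem F) pl.
  by exists f, l; split.
have ut : uniq t by apply: subseq_uniq st_l _; case/andP: ul.
have ok t' : subseq t' t -> okw F t'.
  move=> st'; rewrite /okw (subseq_uniq st' ut); apply/allP => g /(mem_subseq st') gt.
  have -> : g \notin F by exact: nt.
  by have /andP [_ ->] := cl g (mem_subseq st_l gt).
have clext t' : subseq t' t -> all_closed (ext F f t') st.2.
  move=> st'; apply/all_closedP => g; rewrite finset.in_setU => /orP [/clF //|].
  by rewrite inE => /(mem_subseq st') /(mem_subseq st_l) /cl /andP [].
apply: (@le_trans _ _ (\sum_(i < L) \sum_(t <- walks i h)
       (okw F t && (last h t != f))%:R * (ind (ext F f t) (last h t) st)%:R +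
     \sum_(t <- walks L h) (okw F t)%:R * (all_closed (ext F f t) st.2)%:R)); last first.
  rewrite (bigD1 h) //= lerDl; apply: sumr_ge0 => g _.
  by rewrite addr_ge0 // sumr_ge0.
case: (ltnP (size t) L) => szt.
  apply: (@le_trans _ _ (\sum_(i < L) \sum_(t <- walks i h)
       (okw F t && (last h t != f))%:R * (ind (ext F f t) (last h t) st)%:R)); last by rewrite lerDl.
  rewrite (bigD1 (Ordinal szt)) //=.
  apply: (@le_trans _ _ (\sum_(t <- walks (size t) h)
       (okw F t && (last h t != f))%:R * (ind (ext F f t) (last h t) st)%:R)); last first.
    by rewrite lerDl sumr_ge0.
  have tw : t \in walks (size t) h by apply/walksP.
  apply: le_trans (sum_ge_mem _ tw); last by move=> t'; rewrite mulr_ge0 ?ler0n.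
  have inl : inbox ctr rho (base (last f l)).
    rewrite -lt; apply: (@inbox_le _ _ (m + size t)); first by rewrite -(subnKC mr) leq_add2l -ltnS.
    exact: inbox_trans (Fin h hF) (path_inbox pt).
  move: lastl; rewrite inl /= => /and3P [lf Xl Yl].
  by rewrite lt ok // lf /ind clext // Xl Yl mulr1.
apply: (@le_trans _ _ (\sum_(t <- walks L h) (okw F t)%:R * (all_closed (ext F f t) st.2)%:R)); last first.
  by rewrite lerDr sumr_ge0.
have tw : take L t \in walks L h.
  apply/walksP; split; first by rewrite size_takel.
  by move: pt; rewrite -{1}(cat_take_drop L t) cat_path => /andP [].
apply: le_trans (sum_ge_mem _ tw); last by move=> t'; rewrite mulr_ge0 ?ler0n.
have stk : subseq (take L t) t by exact: take_subseq.
by rewrite ok // clext // mulr1.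
Qed.

Hypothesis small : 64 * Delta * eps p q <= 1.

(** Since [Delta * lam = 1 / 8], sums over walks stay geometric even with an extra factor 2 per unit
    of length; and [lam] still exceeds [eps] by a factor 8. *)
Definition lam : R := (8 * Delta)^-1.

Lemma Delta_ge1 : 1 <= Delta.
Proof.
by rewrite -[1]/(1%:R) ler_nat muln_gt0 expn_gt0 andbT; case: (i0) => k /=; case: d.
Qed.

Lemma lam_gt0 : 0 < lam.
Proof. by rewrite invr_gt0 mulr_gt0 // (lt_le_trans ltr01) // Delta_ge1. Qed.

Lemma Delta_lam : Delta * lam = 8^-1.
Proof.
rewrite /lam invfM mulrCA divff ?mulr1 // gt_eqF // (lt_le_trans ltr01) //; exact: Delta_ge1.
Qed.

Lemma eps_lam : eps p q <= lam / 8.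
Proof.
rewrite /lam -invfM -[leRHS]mul1r ler_pdivlMr; last first.
  by rewrite !mulr_gt0 // (lt_le_trans ltr01) // Delta_ge1.
by apply: le_trans small; rewrite le_eqVlt; apply/orP; left; apply/eqP; ring.
Qed.

Lemma geom_quarter n : \sum_(i < n) (4^-1 : R) ^+ i <= 2.
Proof.
suff : \sum_(i < n) (4^-1 : R) ^+ i <= 2 - 2 * 4^-1 ^+ n.
  by move=> /le_trans -> //; rewrite gerBl mulr_ge0 // exprn_ge0 // invr_ge0.
elim: n => [|n IH]; first by rewrite big_ord0 expr0; lra.
rewrite big_ord_recr /=; apply: (le_trans (lerD IH (lexx _))).
have : 0 <= (4^-1 : R) ^+ n by rewrite exprn_ge0 // invr_ge0.
by rewrite exprSr; move: (_ ^+ n) => y y0; lra.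
Qed.

Lemma size_walks_le n h : (size (walks n h))%:R <= Delta ^+ n.
Proof. by rewrite -natrX ler_nat; exact/size_walks/eadj_deg. Qed.

Lemma sum_walks_at n h (G : seq (Et s) -> R) (c : R) : 0 <= c ->
  (forall t, t \in walks n h -> G t <= c) -> \sum_(t <- walks n h) G t <= Delta ^+ n * c.
Proof.
move=> c0 Gc; rewrite big_seq.
apply: (@le_trans _ _ (\sum_(t <- walks n h | t \in walks n h) c)); first exact: ler_sum.
rewrite -big_seq big_const_seq count_predT iter_addr_0 -[c *+ _]mulr_natl.
by apply: ler_wpM2r => //; exact: size_walks_le.
Qed.

(* The first summand is the decay in time of discrepancies present at time 0, the
   second one the influence of the discrepancies outside the box. *)
Lemma killed_discrepancy k F f m :
  f \in F -> (forall g, g \in F -> inbox ctr m (base g)) -> (m <= rho)%N ->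
  \sum_st killed U j p q mu ctr rho.+2 k st * (ind F f st)%:R <=
    lam ^+ #|F| * ((1 - (2 * N%:R)^-1) ^+ k + 2 ^+ m / 2 ^+ rho).
Proof.
have h84 : 8^-1 * 2 = 4^-1 :> R by lra.
have h81 : 8^-1 <= 1 :> R by lra.
have h82 : 8^-1 <= 2^-1 :> R by lra.
have alg1 (y z : R) : 0 <= z -> y <= 2 -> y * z + z <= 3 * z.
  by move=> z0 y2; rewrite -{2}[z]mul1r -mulrDl ler_wpM2r //; lra.
have alg3 (D l a : R) i : D ^+ i * a * l ^+ i * 2 ^+ i = (D * l * 2) ^+ i * a.
  rewrite !exprMn; move: (D ^+ i) (l ^+ i) (2 ^+ i) => x y z; ring.
have alg2 (u v a b : R) : u <= v / 8 -> 1 * b <= v -> a - v + u + 3 * u <= a - 2^-1 * b by lra.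
have alg4 (e n l x : R) : e * (n * (3 * l * x)) = 3 * (n * (e * (l * x))) by ring.
have alg5 (n l y x : R) : n * (l / 8 * (y * x)) = n * (l * y * x) / 8 by ring.
have e0 : 0 < eps p q by exact: eps_gt0.
have l0 := lam_gt0.
have w0 n : 0 <= 2 ^+ n / 2 ^+ rho :> R by rewrite mulr_ge0 ?invr_ge0 ?exprn_ge0.
have N1 : 1 <= N%:R :> R by rewrite -[1]/(1%:R) ler_nat.
have a0 : 0 <= 1 - (2 * N%:R)^-1 :> R.
  rewrite subr_ge0 invf_le1; lra.
have el : eps p q <= lam by have := eps_lam; lra.
elim: k F f m => [|k IH] F f m fF Fin mr.
  apply: (@le_trans _ _ (lam ^+ #|F|)); last first.
    by rewrite expr0 mulrDr mulr1 lerDl mulr_ge0 // exprn_ge0 // ltW.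
  apply: (@le_trans _ _ (eps p q ^+ #|F|)); last by rewrite lerXn2r // nnegrE ltW.
  apply: le_trans (killed_closed p0 p1 q1 Npos stat (ctr := ctr) (rad := rho.+2) 0 _ _) => //.
    apply: ler_sum => st _; apply: ler_wpM2l; first exact: killed_ge0.
    by rewrite /ind; case: (all_closed _ _); rewrite //= ler_nat; case: (_ && _).
  by move=> g gF; apply: inbox_le (Fin g gF); exact: leqW.
set al := 1 - (2 * N%:R)^-1 in a0 IH *.
pose x := al ^+ k + 2 ^+ m / 2 ^+ rho.
have x0 : 0 <= x by rewrite addr_ge0 ?exprn_ge0.
pose S (G : cfg s * cfg s -> R) := \sum_st killed U j p q mu ctr rho.+2 k st * G st.
have S_le (G H : cfg s * cfg s -> R) :
    (forall st, calm U j ctr rho.+2 st.2 -> ~~ TB st.2 -> G st <= H st) -> S G <= S H.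
  move=> GH; apply: ler_sum => st _.
  have k0 := killed_ge0 stat ctr rho.+2 k st.
  case: (eqVneq (killed U j p q mu ctr rho.+2 k st) 0) => [->|ne]; first by rewrite !mul0r.
  have [cs /andP [nT _]] := killed_neq0 stat ne.
  by apply: ler_wpM2l => //; exact: GH.
have S_sum (I : Type) (r : seq I) (P : pred I) (G : I -> cfg s * cfg s -> R) :
    S (fun st => \sum_(i <- r | P i) G i st) = \sum_(i <- r | P i) S (G i).
  rewrite /S exchange_big /=; apply: eq_bigr => st _; rewrite mulr_sumr //.
have S_scale a (G : cfg s * cfg s -> R) : S (fun st => a * G st) = a * S G.
  by rewrite /S mulr_sumr; apply: eq_bigr => st _; rewrite mulrCA.
have S_add (G H : cfg s * cfg s -> R) : S (fun st => G st + H st) = S G + S H.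
  by rewrite /S -big_split /=; apply: eq_bigr => st _; rewrite mulrDr.
pose Z st : R := \sum_(h in F) (\sum_(i < (rho - m).+1) \sum_(t <- walks i h)
       (okw F t && (last h t != f))%:R * (ind (ext F f t) (last h t) st)%:R +
     \sum_(t <- walks (rho - m).+1 h) (okw F t)%:R * (all_closed (ext F f t) st.2)%:R).
pose n := #|F|.
have n1 : (0 < n)%N by rewrite /n card_gt0; apply/set0Pn; exists f.
have nS : lam ^+ n = lam * lam ^+ n.-1 by rewrite -exprS prednK.
have ln0 : 0 <= lam ^+ n.-1 by rewrite exprn_ge0 // ltW.
(* The induction hypothesis for a set that reaches further, up to radius [m']: the second summand of
   [x] doubles with each unit of radius, and the first is bounded just as crudely. *)
have bind f' F' m' : f' \in F' -> (forall g, g \in F' -> inbox ctr m' (base g)) ->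
    (m <= m' <= rho)%N -> S (fun st => (ind F' f' st)%:R) <= lam ^+ #|F'| * (2 ^+ (m' - m) * x).
  move=> fF' Fin' /andP [mm' mr']; apply: le_trans (IH F' f' m' fF' Fin' mr') _.
  apply: ler_wpM2l; first by rewrite exprn_ge0 // ltW.
  rewrite /x mulrDr mulrA -exprD subnK // lerD2r ler_peMl ?exprn_ge0 //.
  by rewrite exprn_ege1 // ler1n.
have SZ : S Z <= n%:R * (3 * lam ^+ n.-1 * x).
  rewrite /Z S_sum mulr_natl -sumr_const; apply: ler_sum => h hF.
  rewrite S_add S_sum.
  (* A walk of length [i] contributes [Delta ^ i] choices, [lam ^ i] for its new edges and [2 ^ i]
     for the gain in radius, together [4 ^ - i]. *)
  have B3 : \sum_(i < (rho - m).+1) S (fun st => \sum_(t <- walks i h)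
       (okw F t && (last h t != f))%:R * (ind (ext F f t) (last h t) st)%:R) <=
       \sum_(i < (rho - m).+1) 4^-1 ^+ i * (lam ^+ n.-1 * x).
    apply: ler_sum => i _; rewrite S_sum.
    have -> : 4^-1 ^+ i * (lam ^+ n.-1 * x) = Delta ^+ i * (lam ^+ (n.-1 + i) * (2 ^+ i * x)).
      rewrite exprD !mulrA; congr (_ * x).
      rewrite (_ : Delta ^+ i * lam ^+ n.-1 * lam ^+ i * 2 ^+ i = (Delta * lam * 2) ^+ i * lam ^+ n.-1).
        by rewrite Delta_lam h84.
      exact: alg3.
    have T0 : 0 <= lam ^+ (n.-1 + i) * (2 ^+ i * x).
      by apply: mulr_ge0; [rewrite exprn_ge0 // ltW|rewrite mulr_ge0 // exprn_ge0].
    apply: sum_walks_at => //.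
    move=> t /walksP [szt pt]; rewrite S_scale.
    case: (boolP (okw F t && _)) => [/andP [okt lf]|_]; last first.
      by rewrite mul0r.
    rewrite mul1r -szt -(card_ext fF okt).
    have -> : 2 ^+ size t * x = 2 ^+ ((m + size t) - m) * x by rewrite addKn.
    apply: bind.
    - rewrite finset.in_setU; case: t {szt} pt okt lf => [|g t] /= pt okt lf.
        by rewrite finset.in_setD1 lf hF.
      by apply/orP; right; rewrite finset.in_set; exact: mem_last.
    - move=> g; rewrite finset.in_setU => /orP [|].
        by rewrite finset.in_setD1 => /andP [_ /Fin]; apply: inbox_le; exact: leq_addr.
      by rewrite inE => gt; apply: inbox_trans (Fin h hF) (path_inbox_mem pt gt).
    - by rewrite leq_addr /= szt -[leqRHS](subnKC mr) leq_add2l -ltnS ltn_ord.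
  (* For a walk long enough to reach the edge of the box the discrepancy is forgotten: closedness
     alone gives [(Delta * lam) ^ L], which is at most [2 ^ m / 2 ^ rho]. *)
  have B4 : S (fun st => \sum_(t <- walks (rho - m).+1 h)
      (okw F t)%:R * (all_closed (ext F f t) st.2)%:R) <= lam ^+ n.-1 * x.
    rewrite S_sum; set L := (rho - m).+1.
    apply: (@le_trans _ _ (Delta ^+ L * lam ^+ (n.-1 + L))).
      apply: sum_walks_at; first by rewrite exprn_ge0 // ltW.
      move=> t /walksP [szt pt]; rewrite S_scale.
      case: (boolP (okw F t)) => [okt|_]; last by rewrite mul0r exprn_ge0 // ltW.
      rewrite mul1r -szt -(card_ext fF okt).
      apply: (@le_trans _ _ (eps p q ^+ #|ext F f t|)); last by rewrite lerXn2r // nnegrE ltW.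
      apply: (killed_closed p0 p1 q1 Npos stat) => // g; rewrite finset.in_setU => /orP [|].
        by rewrite finset.in_setD1 => /andP [_ /Fin]; apply: inbox_le; exact: leqW.
      by rewrite inE; move: okt => /andP [_ /allP H] /H /andP [].
    rewrite exprD mulrCA -exprMn Delta_lam; apply: ler_wpM2l => //.
    apply: (@le_trans _ _ (2 ^+ m / 2 ^+ rho)); last by rewrite lerDr exprn_ge0.
    rewrite (_ : 2 ^+ m / 2 ^+ rho = 2^-1 ^+ (rho - m)); last first.
      have -> : 2 ^+ rho = 2 ^+ (rho - m) * 2 ^+ m :> R by rewrite -exprD subnK.
      rewrite exprVn invfM mulrCA divff ?mulr1 //.
    apply: (@le_trans _ _ (8^-1 ^+ (rho - m))).
      by rewrite /L exprS ler_piMl ?exprn_ge0 ?invr_ge0.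
    by rewrite lerXn2r ?nnegrE ?invr_ge0.
  apply: le_trans (lerD B3 B4) _.
  rewrite -mulr_suml -[leRHS]mulrA; apply: alg1 (geom_quarter _).
  by rewrite mulr_ge0.
apply: le_trans (killed_step stat ctr rho.+2 k F f) _.
have -> : \sum_st killed U j p q mu ctr rho.+2 k st * Kop U j p q (fun st => (ind F f st)%:R) st
    = S (Kop U j p q (fun st => (ind F f st)%:R)) by [].
apply: (@le_trans _ _ (S (fun st => (N%:R)^-1 *
   ((#|~: F|)%:R * (ind F f st)%:R + \sum_(e in F :\ f) eps p q * (ind (F :\ e) f st)%:R +
    eps p q * Z st)))).
  apply: S_le => st cs nT.
  apply: le_trans (Kop_ind p0 p1 q1 nT cs _ fF) _.
    by move=> g /Fin; apply: inbox_le; exact: leqW.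
  apply: ler_wpM2l; first by rewrite invr_ge0 ler0n.
  by rewrite lerD2l ler_pM2l //; exact: discrepancy_sum.
rewrite S_scale S_add S_add S_scale S_sum S_scale.
have C1 := bind f F m fF Fin; rewrite leqnn mr subnn expr0 mul1r in C1; have {}C1 := C1 isT.
have C2 : \sum_(e in F :\ f) S (fun st => eps p q * (ind (F :\ e) f st)%:R) <=
    n%:R * (eps p q * (lam ^+ n.-1 * x)).
  apply: (@le_trans _ _ (\sum_(e in F :\ f) eps p q * (lam ^+ n.-1 * x))).
    apply: ler_sum => e; rewrite !inE => /andP [ef eF]; rewrite S_scale ler_pM2l //.
    have cF : #|F :\ e| = n.-1 by rewrite /n (cardsD1 e F) eF.
    rewrite -cF; have := bind f (F :\ e) m; rewrite leqnn mr subnn expr0 mul1r; apply=> //.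
      by rewrite !inE eq_sym ef.
    by move=> g; rewrite !inE => /andP [_ /Fin].
  rewrite sumr_const -[_ *+ _]mulr_natl; apply: ler_wpM2r.
    by apply: mulr_ge0; [exact: ltW|exact: mulr_ge0].
  by rewrite ler_nat; apply: subset_leq_card; exact: subD1set.
have cC : (#|~: F|)%:R = N%:R - n%:R :> R.
  by rewrite -natrB ?max_card // -(cardsC F) addKn.
have {}e0 := ltW e0.
(* With [eps <= lam / 8] the three terms of [Kop_ind] have total coefficient at most
   [N - n + n / 8 + 3 * n / 8], which for [n >= 1] is at most [N - 1 / 2 = al * N]. This is where
   the rate comes from. *)
apply: (@le_trans _ _ (al * (lam ^+ n * x))); last first.
  rewrite mulrCA; apply: ler_wpM2l; first by rewrite exprn_ge0 // ltW.
  rewrite /x mulrDr -exprS lerD2l ler_piMl // /al gerBl invr_ge0 mulr_ge0 ?ler0n //.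
rewrite cC mulrC ler_pdivrMr; last by rewrite (lt_le_trans ltr01).
have nN : n%:R <= N%:R :> R by rewrite ler_nat max_card.
have n1R : 1 <= n%:R :> R by rewrite -[1]/(1%:R) ler_nat.
have E1 : (N%:R - n%:R) * S (fun st => (ind F f st)%:R) <= (N%:R - n%:R) * (lam ^+ n * x).
  by apply: ler_wpM2l => //; rewrite subr_ge0.
have E2 : eps p q * S Z <= eps p q * (n%:R * (3 * lam ^+ n.-1 * x)) by apply: ler_wpM2l.
have alN : al * N%:R = N%:R - 2^-1.
  rewrite /al mulrBl mul1r invfM -mulrA mulVf ?mulr1 //.
  by rewrite gt_eqF // (lt_le_trans ltr01).
have y0 : 0 <= lam ^+ n.-1 * x by rewrite mulr_ge0.
have E3 : n%:R * (eps p q * (lam ^+ n.-1 * x)) <= n%:R * (lam / 8 * (lam ^+ n.-1 * x)).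
  by apply: ler_wpM2l; rewrite ?ler0n // ler_wpM2r // eps_lam.
have -> : al * (lam ^+ n * x) * N%:R = (N%:R - 2^-1) * (lam ^+ n * x) by rewrite -alN mulrAC.
apply: le_trans (lerD (lerD E1 C2) E2) _.
have -> : eps p q * (n%:R * (3 * lam ^+ n.-1 * x)) =
   3 * (n%:R * (eps p q * (lam ^+ n.-1 * x))) by exact: alg4.
have E4 : n%:R * (lam / 8 * (lam ^+ n.-1 * x)) = n%:R * (lam ^+ n * x) / 8 by rewrite nS; exact: alg5.
rewrite E4 in E3; clear E4.
have z0 : 0 <= lam ^+ n * x by rewrite mulr_ge0 // exprn_ge0 // ltW.
have E5 : 1 * (lam ^+ n * x) <= n%:R * (lam ^+ n * x) by apply: ler_wpM2r.
rewrite !mulrBl; exact: alg2.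
Qed.

End Discrepancy.

(** * Isolated pivotal edges and interface edges *)

Section BadEdge.
Variables (R : realType) (d : nat) (s : seq (zpt d)) (U : 'M[R]_d) (j : 'I_d).
Variables (i0 i1 : 'I_d) (i01 : i0 != i1).
Implicit Types (st : cfg s * cfg s) (w : cfg s) (e f g h : Et s) (F : {set Et s}).
Local Notation TB := (TBconn U j).

Definition bad_at (r : R) st e : Prop :=
  [/\ pivotal U j st.2 e || (st.1 e != st.2 e),
      forall f : zedge d, ~~ Defs.inE s f -> r <= (Defs.edist (emb e) f)%:R &
      forall f : Et s, pivotal U j st.2 f -> f != e -> r <= (Defs.edist (emb e) (emb f))%:R].

(** A point outside [s] would be the base of an edge outside the box. The factor [d] compares the
    lattice distance with the sup-distance. *)
Lemma bad_at_box r st e n : bad_at r st e -> (d * n)%:R < r ->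
  forall x, inbox (base e) n x -> x \in s.
Proof.
move=> [_ far _] nr x bx; apply: contraT => xs.
have := far (x, i0); rewrite /Defs.inE /= (negbTE xs) => /(_ isT).
rewrite leNgt => /negP []; apply: le_lt_trans nr; rewrite ler_nat.
exact: (@edist_inbox _ n (emb e) (x, i0)).
Qed.

Lemma bad_at_pivotal r st e n : bad_at r st e -> (d * n)%:R < r ->
  forall g, inbox (base e) n (base g) -> pivotal U j st.2 g -> g = e.
Proof.
move=> [_ _ far] nr g bg pg; apply/eqP; apply: contraT => ge.
have := far g pg ge; rewrite leNgt => /negP []; apply: le_lt_trans nr; rewrite ler_nat.
exact: edist_inbox.
Qed.

Lemma prob_bad_le (mu : cfg s * cfg s -> R) r : (forall st, 0 <= mu st) ->
  prob mu (bad_event U j r) <= \sum_e \sum_st mu st * (`[< bad_at r st e >])%:R.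
Proof.
move=> mu0; rewrite exchange_big /prob big_mkcond /=; apply: ler_sum => st _.
case: asboolP => [[e be]|_]; last first.
  by apply: sumr_ge0 => e _; rewrite mulr_ge0.
rewrite (bigD1 e) //= (_ : `[< bad_at r st e >] = true) ?mulr1; last exact/asboolP.
by rewrite lerDl sumr_ge0 // => g _; rewrite mulr_ge0.
Qed.

(* The three other edges of a unit square through [e] cannot all be open. *)
Lemma square_pivotal w e : ~~ TB w -> (forall g, ~~ w g -> pivotal U j w g) ->
  (forall x, inbox (base e) 2 x -> x \in s) -> pivotal U j w e ->
  exists g, [/\ g != e, pivotal U j w g & inbox (base e) 1 (base g)].
Proof.
move=> nT cp bs pe; apply: contrapT => no.
have opn g : g != e -> inbox (base e) 1 (base g) -> w g.
  move=> ge bg; apply: contraT => /cp pg; case: no; by exists g.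
pose i := (emb e).2; pose x := base e.
have [k ki] : exists k : 'I_d, k != i.
  by case: (eqVneq i0 i) => [E|ne]; [exists i1; rewrite -E eq_sym|exists i0].
have xe : emb e = (x, i) by rewrite /x /i -surjective_pairing.
have b1 y : inbox x 1 y -> y \in s by move=> by_; apply: bs; apply: inbox_le by_.
have b2 y z : inbox x 1 y -> inbox y 1 z -> z \in s.
  by move=> h1 h2; apply: bs; apply: (inbox_trans h1 h2).
have [g1 E1] := embP (b1 _ (inbox_refl _ _)) (b1 _ (inbox_zmove x k)).
have [g2 E2] := embP (b1 _ (inbox_zmove x i)) (b2 _ _ (inbox_zmove x i) (inbox_zmove _ k)).
have [g3 E3] := embP (b1 _ (inbox_zmove x k)) (b2 _ _ (inbox_zmove x k) (inbox_zmove _ i)).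
have w1 : w g1.
  apply: opn; last by rewrite {2}/base E1 inbox_refl.
  by apply: contraNneq ki => E; move: E1; rewrite E xe => -[->].
have w2 : w g2.
  apply: opn; last by rewrite {2}/base E2 inbox_zmove.
  by apply: contraNneq ki => E; move: E2; rewrite E xe => -[_ ->].
have w3 : w g3.
  apply: opn; last by rewrite {2}/base E3 inbox_zmove.
  apply/eqP => E; move: E3; rewrite E xe => -[/ffunP /(_ k)].
  by rewrite zmoveE eqxx /=; move: (x k) => y; lia.
have L g : w g -> connect (augrel U j w) (inl (end1 g)) (inl (end2 g)).
  by move=> wg; apply: connect1; apply/openrelP; exists g; rewrite // /joins !eqxx.
have C : connect (augrel U j w) (inl (end1 e)) (inl (end2 e)).
  have e11 : end1 e = end1 g1 by apply: val_inj; rewrite !val_end1 /base E1 xe.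
  have e13 : end2 g1 = end1 g3.
    by apply: val_inj; rewrite val_end1 val_end2 /base /zend2 E1 E3.
  have e32 : end2 g3 = end2 g2.
    by apply: val_inj; rewrite !val_end2 /zend2 E2 E3 /= zmoveC.
  have e2e : end1 g2 = end2 e.
    by apply: val_inj; rewrite val_end1 val_end2 /base /zend2 E2 xe.
  rewrite e11; apply: connect_trans (L _ w1) _; rewrite e13.
  apply: connect_trans (L _ w3) _; rewrite e32 aug_connect_sym -e2e; exact: L.
(* Each cluster contains an endpoint of the pivotal edge [e], hence both endpoints, now that these
   are connected. *)
have r1 b : reach U j w b (end1 e).
  have /orP [//|r2] := pivotal_reach b nT pe.
  by apply: connect_trans r2 _; rewrite aug_connect_sym.
by have := reach_disj nT (r1 true); rewrite r1.
Qed.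

End BadEdge.

(** * The case [p = 1] *)

Section FullDensity.
Variables (R : realType) (d : nat) (s : seq (zpt d)) (U : 'M[R]_d) (j : 'I_d) (q : R).
Variables (i0 i1 : 'I_d) (i01 : i0 != i1) (Npos : (0 < #|{: Et s}|)%N).
Variable mu : cfg s * cfg s -> R.
Hypothesis stat : stationary U j 1 q mu.
Implicit Types (st : cfg s * cfg s) (w : cfg s) (e f g h : Et s).
Local Notation N := #|{: Et s}|.

Lemma theta_full w e : theta U j 1 q w e = 0.
Proof.
rewrite /theta (_ : PhiTB U j 1 q (upd w e false) = 0) ?mul0r //.
by rewrite /PhiTB /FKweight (bigD1 e) //= updE eqxx subrr !mul0r.
Qed.

(** The thresholds are 0, so an updated edge of Y opens exactly when it is not pivotal. *)
Lemma Kop_full st e : Kop U j 1 q (fun st => (st.2 e)%:R) st =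
  (N%:R)^-1 * ((N%:R - 1) * (st.2 e)%:R + (~~ pivotal U j st.2 e)%:R).
Proof.
rewrite /Kop; congr (_ * _); rewrite (bigD1 e) //= addrC; congr (_ + _).
  rewrite (eq_bigr (fun=> (st.2 e)%:R)); last first.
    move=> g ge; rewrite sum_bool2 /= !updE eq_sym (negbTE ge) -!mulrDl.
    rewrite /flip_mass split_mass_open ?split_mass_closed ?theta_full ?lexx ?ler01 //.
    by case: (pivotal _ _ _ _); rewrite ?add0r ?subr0 ?addr0 mul1r.
  rewrite sumr_const -[_ *+ _]mulr_natl; congr (_ * _).
  by rewrite (_ : #|_| = N.-1) ?predn_int // ?cardC1 // -subn1 natrB.
rewrite sum_bool2 /= !updE eqxx !mulr0 !addr0 !mulr1.
rewrite /flip_mass split_mass_open ?theta_full ?lexx ?ler01 //.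
by case: (pivotal _ _ _ _); rewrite ?subr0.
Qed.

(** By stationarity [e] is open in Y with the same probability as it is not pivotal. An open edge is
    never pivotal, so the two events agree almost surely. *)
Lemma full_closed_pivotal st : mu st != 0 -> forall e, ~~ st.2 e -> pivotal U j st.2 e.
Proof.
move=> ne e; apply: contraNT => npe.
case: (stat) => mu0 mu1 mus _.
have E : \sum_st mu st * (st.2 e)%:R = \sum_st mu st * (~~ pivotal U j st.2 e)%:R.
  have := mu_inv stat (fun st => (st.2 e)%:R).
  rewrite [X in _ = X](eq_bigr (fun st => (N%:R)^-1 * ((N%:R - 1) * (mu st * (st.2 e)%:R) +
      mu st * (~~ pivotal U j st.2 e)%:R))); last by move=> st' _; rewrite Kop_full; ring.
  rewrite -mulr_sumr big_split /= -mulr_sumr.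
  have : (N%:R : R) != 0 by rewrite pnatr_eq0 -lt0n.
  move: (\sum_st _) (\sum_st _) (N%:R) => y x n n0 H.
  have : n * x = (n - 1) * x + y by rewrite {1}H mulrA divff // mul1r.
  lra.
have le st' : mu st' * (st'.2 e)%:R <= mu st' * (~~ pivotal U j st'.2 e)%:R.
  case: (eqVneq (mu st') 0) => [->|ne']; first by rewrite !mul0r.
  apply: ler_wpM2l => //; rewrite ler_nat.
  have /andP [nT _] : state_space U j st' by apply: contraNT ne' => /mus ->.
  case: (boolP (st'.2 e)) => // we; rewrite /pivotal lt0b.
  by have -> : upd st'.2 e true = st'.2 by rewrite -{2}(upd_id st'.2 e) we.
have Z : \sum_st (mu st * (~~ pivotal U j st.2 e)%:R - mu st * (st.2 e)%:R) = 0.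
  by rewrite sumrB E subrr.
have /eqP := Z; rewrite psumr_eq0; last by move=> st' _; rewrite subr_ge0.
move=> /allP /(_ st (mem_index_enum _)) /=; rewrite npe mulr1 subr_eq0.
by case: (st.2 e); rewrite // mulr0 (negbTE ne).
Qed.

Lemma full_density_bad r : d%:R * 2 < r -> prob mu (bad_event U j r) = 0.
Proof.
move=> dr; rewrite /prob big1 // => st /asboolP [e be]; apply/eqP; apply: contraT => ne.
have {}be : bad_at U j r st e := be.
case: (stat) => _ _ mus _.
have /andP [nT /forallP le] : state_space U j st by apply: contraNT ne => /mus ->.
have cp := full_closed_pivotal ne.
have dr2 : (d * 2)%:R < r by rewrite natrM.
have dr1 : (d * 1)%:R < r by apply: le_lt_trans dr2; rewrite ler_nat leq_mul.
have pe : pivotal U j st.2 e.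
  case: (be) => /orP [//|xy] _ _; apply: cp; apply: contraNN xy => ye.
  by have := le e; rewrite ye /= => ->.
have [g [ge pg bg]] := square_pivotal i01 nT cp (bad_at_box i0 be dr2) pe.
by case/eqP: ge; exact: (bad_at_pivotal be dr1 bg pg).
Qed.

End FullDensity.

(** * The case [p < 1] *)

Section PartialDensity.
Variables (R : realType) (d : nat) (s : seq (zpt d)) (U : 'M[R]_d) (j : 'I_d) (p q : R).
Hypotheses (p0 : 0 < p) (p1 : p < 1) (q1 : 1 <= q) (Npos : (0 < #|{: Et s}|)%N).
Variable mu : cfg s * cfg s -> R.
Hypothesis stat : stationary U j p q mu.
Variables (i0 i1 : 'I_d) (i01 : i0 != i1).
Implicit Types (st : cfg s * cfg s) (w : cfg s) (e f g h : Et s) (F : {set Et s}).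
Local Notation N := #|{: Et s}|.
Local Notation Delta := ((d * 3 ^ d)%:R : R).
Local Notation TB := (TBconn U j).
Local Notation calm := (calm U j).
Local Notation walks := (walks (@eadj d s)).
Hypothesis small : 64 * Delta * eps p q <= 1.

(** At most one of the [l.+2] edges of the walk, [e] itself, is spared; at least [l.+1] are opened
    together, each at cost [eps]. *)
Lemma isolated_pivotal e l :
  \sum_st mu st * (`[< ~~ TB st.2 /\ exists f t, [/\ t \in walks l.+1 f, uniq (f :: t)
     & all_closed ([set g in f :: t] :\ e) st.2 /\
       ~~ TB (open_all st.2 [in [set g in f :: t] :\ e])] >])%:R
  <= N%:R * Delta ^+ l.+1 * eps p q ^+ l.+1.
Proof.
have e0 : 0 < eps p q by exact: eps_gt0.
have e1 : eps p q <= 1.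
  have D1 := Delta_ge1 R i0; apply: le_trans small.
  by rewrite ler_peMl ?ltW //; lra.
pose fs f t := [set g in f :: t] :\ e.
pose ev (x : Et s * seq (Et s)) w := all_closed (fs x.1 x.2) w && ~~ TB (open_all w [in fs x.1 x.2]).
apply: (@le_trans _ _ (\sum_st mu st * \sum_f \sum_(t <- walks l.+1 f)
    (uniq (f :: t) && ev (f, t) st.2)%:R)).
  apply: ler_sum => st _; apply: ler_wpM2l; first exact: (mu_ge0 stat).
  case: asboolP => [[nT [f [t [tw ut [cl op]]]]]|_]; last first.
    by apply: sumr_ge0 => f _; apply: sumr_ge0 => t _; rewrite ler0n.
  apply: (@le_trans _ _ (\sum_(t <- walks l.+1 f) (uniq (f :: t) && ev (f, t) st.2)%:R)); last first.
    rewrite (bigD1 f) //= lerDl; apply: sumr_ge0 => g _; apply: sumr_ge0 => t' _.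
    by rewrite ler0n.
  apply: le_trans (sum_ge_mem _ tw); last by move=> t'; rewrite ler0n.
  by rewrite ut /ev cl op.
rewrite (eq_bigr (fun st => \sum_f \sum_(t <- walks l.+1 f)
    mu st * (uniq (f :: t) && ev (f, t) st.2)%:R)); last first.
  by move=> st _; rewrite mulr_sumr; apply: eq_bigr => f _; rewrite mulr_sumr.
rewrite exchange_big /=; under eq_bigr do rewrite exchange_big /=.
apply: (@sum_walks_le _ _ _ l.+1 (fun f t => \sum_st mu st * (uniq (f :: t) && ev (f, t) st.2)%:R));
  first by rewrite exprn_ge0 // ltW.
move=> f t /walksP [szt pt].
case: (boolP (uniq (f :: t))) => ut; last first.
  by rewrite big1 ?exprn_ge0 ?ltW // => st _; rewrite mulr0.
rewrite (sum_mu_snd p0 p1 q1 Npos stat (fun w => (ev (f, t) w)%:R)).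
apply: le_trans (cond_law_closed U j p0 p1 q1 (fs f t)) _.
apply: ler_wiXn2l => //; first exact: ltW.
have H : ((e \in [set g in f :: t]) + #|fs f t| = l.+2)%N.
  by rewrite -cardsD1 (card_set_uniq ut) /= szt.
by rewrite -ltnS -H -add1n leq_add2r; case: (e \in _).
Qed.

(** With [y = (2 * N)^-1], Bernoulli's inequality gives [(1 + y) ^ (2 * N) >= 2], while
    [(1 - y) * (1 + y) <= 1]. *)
Lemma half_pow (n : nat) : (1 - (2 * N%:R)^-1 : R) ^+ (2 * n * N) <= 2^-1 ^+ n.
Proof.
have N1 : 1 <= N%:R :> R by rewrite -[1]/(1%:R) ler_nat.
pose y : R := (2 * N%:R)^-1.
have y0 : 0 < y by rewrite invr_gt0 mulr_gt0 // (lt_le_trans ltr01).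
have y1 : y <= 1 by rewrite invf_le1; lra.
have Ny : (2 * N)%:R * y = 1 by rewrite natrM /y divff // mulf_neq0 // gt_eqF // (lt_le_trans ltr01).
rewrite (_ : 2 * n * N = 2 * N * n)%N; last by rewrite mulnAC.
rewrite exprM -/y; apply: lerXn2r; rewrite ?nnegrE ?invr_ge0 ?exprn_ge0 ?subr_ge0 //.
have B : 2 <= (1 + y) ^+ (2 * N).
  apply: le_trans (exprD_ge (2 * N) ler01 (ltW y0)).
  by rewrite !expr1n mulr1 Ny.
have P : (1 - y) ^+ (2 * N) * (1 + y) ^+ (2 * N) <= 1.
  rewrite -exprMn exprn_ile1 //.
    by rewrite mulr_ge0 ?subr_ge0 // addr_ge0 // ltW.
  by rewrite -subr_sqr expr1n gerBl sqr_ge0.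
rewrite -[leRHS]mul1r ler_pdivlMr //; apply: le_trans P.
by apply: ler_wpM2l => //; rewrite exprn_ge0 // subr_ge0.
Qed.

(** If the box of radius [R0] is calm now, [e] is not pivotal and carries a discrepancy: either
    radius [n.+2] has been calm for [2 * n * N] steps (first summand), or calm failed at one of
    these times (second). If it is not calm, a closed walk crosses the region where only [e] can be
    pivotal (third). *)
Lemma bad_at_bound (r : R) (n : nat) e : (d * (2 * n ^ 2 + 6 * n + 4))%:R < r ->
  \sum_st mu st * (`[< bad_at U j r st e >])%:R <=
  2^-1 ^+ n / 4 + ((2 * n * N).+1%:R * ((2 * n)%:R * (N%:R * 32^-1 ^+ n)) + N%:R * 32^-1 ^+ n).
Proof.
move=> dr.
have e0 : 0 < eps p q by exact: eps_gt0.
have D1 : 1 <= Delta by exact: Delta_ge1.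
have c0 : 0 <= N%:R * 32^-1 ^+ n :> R by rewrite mulr_ge0 ?ler0n // exprn_ge0 // invr_ge0.
have De : Delta * eps p q <= 64^-1.
  by rewrite -[leRHS]mul1r ler_pdivlMr // mulrC mulrA.
have e1 : eps p q <= 64^-1 by apply: le_trans De; rewrite ler_peMl // ltW.
pose rad := (2 * n ^ 2 + 6 * n + 4)%N; pose ctr := base e.
(* Radius [n.+2] survives [2 * n] blocks that cost [n.+2] each; [rad] adds the room for a walk of
   length [n.+1]. *)
pose R0 := (n.+2 + 2 * n * n.+2)%N.
have radE : rad = (R0 + n).+2 by rewrite /rad /R0; clear; rewrite expnS expn1; lia.
have leR : (R0 <= rad)%N by rewrite radE -addn2 -addnA leq_addr.
case: (pselect (forall x, inbox ctr rad x -> x \in s)) => [bs|nbs]; last first.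
  rewrite big1; last first.
    move=> st _; case: asboolP => [be|_]; last by rewrite mulr0.
    by case: nbs => x; exact: (bad_at_box i0 be dr).
  apply: addr_ge0; first by rewrite divr_ge0 // exprn_ge0 // invr_ge0.
  by rewrite addr_ge0 // mulr_ge0 ?ler0n // mulr_ge0 ?ler0n.
pose G st : R := (calm ctr R0 st.2 && ind [set e] e st)%:R.
pose iso st : R := (`[< ~~ TB st.2 /\ exists f t, [/\ t \in walks n.+1 f, uniq (f :: t)
     & all_closed ([set g in f :: t] :\ e) st.2 /\
       ~~ TB (open_all st.2 [in [set g in f :: t] :\ e])] >])%:R.
apply: (@le_trans _ _ (\sum_st mu st * G st + \sum_st mu st * iso st)).
  rewrite -big_split /=; apply: ler_sum => st _; rewrite -mulrDr.
  case: (eqVneq (mu st) 0) => [->|ne]; first by rewrite !mul0r.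
  apply: ler_wpM2l; first exact: (mu_ge0 stat).
  case: asboolP => [be|_]; last by rewrite addr_ge0 ?ler0n.
  case: (stat) => _ _ mus _.
  have /andP [nT /forallP le] : state_space U j st by apply: contraNT ne => /mus ->.
  have bp := bad_at_pivotal be dr.
  case: (boolP (calm ctr R0 st.2)) => cs.
    rewrite /G cs /= (_ : ind _ _ _ = true) ?lerDl ?ler0n //.
    have npe : ~~ pivotal U j st.2 e.
      apply: (calm_not_pivotal (ctr := ctr) (r := R0.-1)) => //.
      exact: inbox_refl.
    case: be => /orP [pe|xy _ _]; first by rewrite pe in npe.
    have := le e; move: xy; rewrite /ind; case E2: (st.2 e); case E1: (st.1 e) => //= _ _.
    by rewrite andbT; apply/all_closedP => g; rewrite finset.in_set1 => /eqP ->; rewrite E2.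
  have [|f [t [bf tw ut /allP at_]]] := not_calm_walk (l := n) i01 _ nT cs.
    by move=> x; rewrite -radE; exact: bs.
  rewrite (_ : iso st = 1) ?lerDr ?ler0n // /iso; case: asboolP => // -[]; split=> //.
  exists f, t; split=> //.
  have inFE g : g \in [set g in f :: t] :\ e -> g != e /\ g \in f :: t.
    by rewrite finset.in_setD1 finset.in_set => /andP [].
  split; first by apply/all_closedP => g /inFE [_ /at_ /and3P []].
  apply: (openable (b := false)) => // g /inFE [ge /at_ /and3P [_ bg]].
  case/orP => [pg|/andP [] //]; case/eqP: ge; apply: bp pg.
  by apply: inbox_le bg; rewrite -/rad radE.
apply: le_trans (lerD (lexx _) (isolated_pivotal e n)) _.
rewrite addrA; apply: lerD; last first.
  rewrite -mulrA; apply: ler_wpM2l; first by rewrite ler0n.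
  rewrite -exprMn; apply: (@le_trans _ _ (64^-1 ^+ n.+1)).
    by apply: lerXn2r; rewrite ?nnegrE ?invr_ge0 // mulr_ge0 ?ler0n // ltW.
  rewrite exprSr; apply: (@le_trans _ _ (64^-1 ^+ n)).
    by rewrite ler_piMr ?exprn_ge0 ?invr_ge0 //; lra.
  by apply: lerXn2r; rewrite ?nnegrE ?invr_ge0 //; lra.
have G0 st : 0 <= G st by rewrite ler0n.
apply: le_trans (killed_split stat ctr n.+2 (2 * n * N) G0) _.
apply: lerD.
  apply: (@le_trans _ _ (\sum_st killed U j p q mu ctr n.+2 (2 * n * N) st * (ind [set e] e st)%:R)).
    apply: ler_sum => st _; apply: ler_wpM2l; first exact: (killed_ge0 stat).
    by rewrite /G ler_nat; case: (calm _ _ _).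
  have bs2 x : inbox ctr n.+2 x -> x \in s.
    by move=> bx; apply: bs; apply: inbox_le bx; apply: leq_trans leR; exact: leq_addr.
  have in1 g : g \in [set e] -> inbox ctr 0 (base g).
    by rewrite finset.in_set1 => /eqP ->; exact: inbox_refl.
  apply: le_trans (killed_discrepancy p0 p1 q1 Npos stat i01 bs2 small
    (2 * n * N) (finset.set11 e) in1 (leq0n _)) _.
  rewrite cards1 expr1 expr0 mul1r.
  have l8 : lam R d <= 8^-1.
    rewrite /lam lef_pV2 ?posrE // ?mulr_gt0 // ?(lt_le_trans ltr01) // ler_peMr //.
  have l0 : 0 <= lam R d by rewrite invr_ge0 mulr_ge0 ?ler0n.
  have h0 : 0 <= 2^-1 ^+ n :> R by rewrite exprn_ge0 // invr_ge0.
  (* One [2 ^ - n] is the decay in time, the other the distance [n] to the edge of the box. *)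
  apply: (@le_trans _ _ (8^-1 * (2^-1 ^+ n + 2^-1 ^+ n))); last first.
    by move: (2^-1 ^+ n) => z; lra.
  apply: ler_pM => //.
    rewrite addr_ge0 // ?invr_ge0 ?exprn_ge0 // subr_ge0 invf_le1.
      by rewrite -natrM -[1]/(1%:R) ler_nat muln_gt0.
    by rewrite -natrM ltr0n muln_gt0.
  by rewrite exprVn; apply: lerD => //; rewrite -exprVn half_pow.
apply: (@le_trans _ _ (\sum_(i < (2 * n * N).+1) (2 * n)%:R * (N%:R * 32^-1 ^+ n))); last first.
  by rewrite sumr_const card_ord -[_ *+ _]mulr_natl.
apply: ler_sum => i _.
have short k a : (k <= N)%N -> (forall x, inbox ctr (a + n).+2 x -> x \in s) ->
    escape s U j p q k ctr (a + n).+2 a <= N%:R * 32^-1 ^+ n.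
  move=> kN bsa; apply: le_trans (escape_short U j p0 p1 q1 Npos i01 kN bsa) _.
  rewrite -mulrA; apply: ler_wpM2l; first by rewrite ler0n.
  rewrite [(_ * eps _ _) ^+ _]exprSr mulrA -exprMn.
  have t0 : 0 <= Delta * (2 * eps p q) by rewrite mulr_ge0 ?ler0n // mulr_ge0 // ltW.
  have t32 : Delta * (2 * eps p q) <= 32^-1 by rewrite mulrCA; lra.
  have z0 : 0 <= (Delta * (2 * eps p q)) ^+ n by rewrite exprn_ge0.
  apply: (@le_trans _ _ ((Delta * (2 * eps p q)) ^+ n)); last first.
    by apply: lerXn2r; rewrite ?nnegrE ?invr_ge0.
  rewrite exprSr -mulrA; apply: ler_piMr => //.
  have h32 : 32^-1 <= 1 :> R by lra.
  have te1 : 2 * eps p q <= 1 by lra.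
  by apply: mulr_ile1 => //; [rewrite mulr_ge0 // ltW|exact: le_trans t32 h32].
have esc : escape s U j p q i ctr R0 n.+2 <= (2 * n)%:R * (N%:R * 32^-1 ^+ n).
  apply: (escape_le p0 p1 q1 Npos i01 short) => //; first by rewrite -ltnS.
  by move=> x bx; apply: bs; exact: inbox_le bx.
(* Not calm [i] steps ago but calm now on a larger box: reversed in time, this is an escape. *)
apply: le_trans esc; rewrite -(escape_rev s U j p0 p1 q1).
rewrite (eq_bigr (fun w => cond_law U j p q w * ((~~ calm ctr n.+2 w)%:R *
  iter i (Qop U j p q) (fun v => (calm ctr R0 v)%:R) w))); last by move=> w _; rewrite mulrA.
rewrite -(sum_mu_snd p0 p1 q1 Npos stat (fun w => (~~ calm ctr n.+2 w)%:R *
  iter i (Qop U j p q) (fun v => (calm ctr R0 v)%:R) w)).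
apply: ler_sum => st _; rewrite -mulrA; apply: ler_wpM2l; first exact: (mu_ge0 stat).
apply: ler_wpM2l; first by rewrite ler0n.
rewrite -(iter_Kop_snd U j p0 p1 q1); apply: iter_Kop_le => st'.
by rewrite /G ler_nat; case: (calm _ _ _); case: (ind _ _ _).
Qed.

Lemma prob_bad_bound (r : R) (n : nat) : (d * (2 * n ^ 2 + 6 * n + 4))%:R < r ->
  prob mu (bad_event U j r) <= N%:R * (2^-1 ^+ n / 4 +
    ((2 * n * N).+1%:R * ((2 * n)%:R * (N%:R * 32^-1 ^+ n)) + N%:R * 32^-1 ^+ n)).
Proof.
move=> dr; apply: le_trans (prob_bad_le _ _ _ (mu_ge0 stat)) _.
rewrite mulr_natl -sumr_const; apply: ler_sum => e _; exact: bad_at_bound.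
Qed.

End PartialDensity.

(** * Numerical estimates and choice of the constants *)

Section Numerics.
Variable R : realType.

Lemma ln2_ge : 2^-1 <= ln 2 :> R.
Proof.
rewrite -(expRK 2^-1) ler_ln ?posrE ?expR_gt0 //.
rewrite -(opprK 2^-1) expRN.
rewrite -[leRHS]invrK lef_pV2 ?posrE ?expR_gt0 ?invr_gt0 //.
by apply: le_trans (expR_ge1Dx _); lra.
Qed.

Lemma ln_ge1 (x : R) : 4 <= x -> 1 <= ln x.
Proof.
move=> x4; apply: (@le_trans _ _ (ln (2 ^+ 2))).
  by rewrite lnXn // -[leRHS]mulr_natl; have := ln2_ge; lra.
by rewrite ler_ln ?posrE ?exprn_gt0 //; [rewrite expr2; lra|lra].
Qed.

Lemma powR_le_pow2 (x c : R) (m : nat) : 1 <= x -> 2 * (c * ln x) <= m%:R ->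
  x `^ c <= 2 ^+ m.
Proof.
move=> x1 le; have x0 : 0 < x by lra.
rewrite /powR gt_eqF // -[leRHS]lnK ?posrE ?exprn_gt0 // ler_expR lnXn //.
rewrite -[leRHS]mulr_natl.
have : m%:R * 2^-1 <= m%:R * ln 2 :> R by rewrite ler_wpM2l ?ler0n // ln2_ge.
lra.
Qed.

(** [24 * 3 ^ 2 = 216], and one more makes the inequality strict. *)
Lemma radius_lt (a x k : R) : 1 <= a -> 1 <= x -> 0 <= k <= 3 * x ->
  a * (24 * k ^+ 2) < 217 * a * x ^+ 2.
Proof.
move=> a1 x1 /andP [k0 k3].
have k2 : k ^+ 2 <= (3 * x) ^+ 2 by apply: lerXn2r; rewrite ?nnegrE //; lra.
have x2 : 1 <= x ^+ 2 by rewrite expr2 mulr_ege1.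
have -> : 217 * a * x ^+ 2 = a * (217 * x ^+ 2) by ring.
rewrite ltr_pM2l; last lra.
by rewrite exprMn in k2; lra.
Qed.

(** With [y = 2 ^ - m], both [N * y] and [m * y] are at most 1. The main term is at most [y / 4];
    elsewhere [32 ^ - (2 * m) = y ^ 10] absorbs the prefactor, at worst [16 * N ^ 3 * m ^ 2], and
    leaves [y * y ^ 4] with [y ^ 4 <= 1 / 256]. *)
Lemma error_sum_le (N m : nat) : (2 <= m)%N -> (1 <= N)%N -> N%:R <= 2 ^+ m :> R ->
  N%:R * (2^-1 ^+ (2 * m) / 4 + ((2 * (2 * m) * N).+1%:R *
     ((2 * (2 * m))%:R * (N%:R * 32^-1 ^+ (2 * m))) + N%:R * 32^-1 ^+ (2 * m)))
  <= (2 ^+ m)^-1 :> R.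
Proof.
move=> m2 N1 N2m; rewrite -exprVn; set y : R := 2^-1 ^+ m.
have y0 : 0 < y by rewrite exprn_gt0 // invr_gt0.
have pow2 : 2 ^+ m * y = 1 by rewrite /y -exprMn divff ?expr1n // gt_eqF.
have -> : 2^-1 ^+ (2 * m) = y ^+ 2 :> R by rewrite mulnC exprM.
have -> : 32^-1 ^+ (2 * m) = y ^+ 10 :> R.
  rewrite (_ : 32^-1 = 2^-1 ^+ 5); last by rewrite exprVn; congr (_^-1); rewrite !exprS expr0; lra.
  by rewrite /y -!exprM; congr (_ ^+ _); lia.
have y4 : y <= 4^-1.
  apply: (@le_trans _ _ (2^-1 ^+ 2)); last by rewrite !exprS expr0; lra.
  by rewrite /y; apply: ler_wiXn2l => //; lra.
have Ny : N%:R * y <= 1 by rewrite -[leRHS]pow2 ler_wpM2r // ltW.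
have my : m%:R * y <= 1.
  rewrite -[leRHS]pow2; apply: ler_wpM2r; first exact: ltW.
  by rewrite -natrX ler_nat; exact/ltnW/ltn_expl.
have Nr1 : 1 <= N%:R :> R by rewrite -[1]/(1%:R) ler_nat.
have mr1 : 1 <= m%:R :> R by rewrite -[1]/(1%:R) ler_nat; lia.
rewrite -(natr1 (2 * (2 * m) * N)%N) !natrM; move: (N%:R) (m%:R) y {pow2 N2m m2 N1} y0 y4 Ny my Nr1 mr1 => n k z z0 z4 nz kz n1 k1.
pose u := n * z; pose v := k * z.
have u0 : 0 <= u by rewrite /u; nra.
have v0 : 0 <= v by rewrite /v; nra.
have E : n * (z ^+ 2 / 4 + ((2 * (2 * k) * n + 1) * (2 * (2 * k) * (n * z ^+ 10)) + n * z ^+ 10)) =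
   z * (u / 4 + 16 * (u ^+ 3 * v ^+ 2 * z ^+ 4) + 4 * (u ^+ 2 * v * z ^+ 6) + u ^+ 2 * z ^+ 7).
  by rewrite /u /v; ring.
rewrite E ger_pMr //.
have z44 : z ^+ 4 <= 256^-1.
  apply: (@le_trans _ _ (4^-1 ^+ 4)); last by rewrite !exprS expr0; lra.
  by apply: lerXn2r; rewrite ?nnegrE ?invr_ge0 // ltW.
have z1 : z <= 1 by lra.
have z04 : 0 <= z ^+ 4 by rewrite exprn_ge0 // ltW.
have bnd (a t : R) : 0 <= a <= 1 -> 0 <= t <= 1 -> 0 <= a * t <= 1.
  by move=> /andP [a0 a1] /andP [t0 t1]; rewrite mulr_ge0 //= mulr_ile1.
have bX (a : R) n' : 0 <= a <= 1 -> 0 <= a ^+ n' <= 1.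
  by move=> /andP [a0 a1]; rewrite exprn_ge0 //= exprn_ile1.
have hu : 0 <= u <= 1 by rewrite u0.
have hv : 0 <= v <= 1 by rewrite v0.
have hz : 0 <= z <= 1 by rewrite ltW.
have t1 : u ^+ 3 * v ^+ 2 * z ^+ 4 <= z ^+ 4.
  by rewrite ler_piMl //; have /andP [] := bnd _ _ (bX u 3 hu) (bX v 2 hv).
have t2 : u ^+ 2 * v * z ^+ 6 <= z ^+ 4.
  rewrite (_ : 6 = 2 + 4)%N // exprD mulrA ler_piMl //.
  by have /andP [] := bnd _ _ (bnd _ _ (bX u 2 hu) hv) (bX z 2 hz).
have t3 : u ^+ 2 * z ^+ 7 <= z ^+ 4.
  rewrite (_ : 7 = 3 + 4)%N // exprD mulrA ler_piMl //.
  by have /andP [] := bnd _ _ (bX u 2 hu) (bX z 3 hz).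
lra.
Qed.

End Numerics.

Theorem theorem1p3 (R : realType) (d : nat) : (2 <= d)%N ->
  forall q : R, 1 <= q ->
  exists pt : R, exists kappa : R, pt < 1 /\ 0 < kappa /\
  forall (p c : R), pt <= p -> p <= 1 -> 1 <= c ->
  forall (U : 'M[R]_d) (L : R) (j : 'I_d) (s : seq (zpt d)),
  is_box U L s ->
  (3 ^ (6 * d))%:R <= (#|{: Et s}|)%:R :> R ->
  (c * d%:R) `^ (c * d%:R ^+ 2) <= (#|{: Et s}|)%:R ->
  forall mu : cfg s * cfg s -> R, stationary U j p q mu ->
  prob mu (bad_event U j (kappa * c ^+ 2 * (ln (#|{: Et s}|)%:R) ^+ 2))
    <= ((#|{: Et s}|)%:R `^ c)^-1.
Proof.
move=> d2 q q1.
have d0 : (0 < d)%N by exact: ltnW.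
pose i0 := Ordinal d0; pose i1 := Ordinal d2.
have i01 : i0 != i1 by [].
pose D : R := (d * 3 ^ d)%:R.
have D1 : 1 <= D by exact: (Delta_ge1 R i0).
have dr1 : 1 <= d%:R :> R by rewrite -[1]/(1%:R) ler_nat.
(* For [p >= 1 - t >= 1 / 2] one has [oddsc p <= 2 * t], hence
   [64 * D * eps <= 128 * D * q * t = 1]. *)
pose t := (128 * D * q)^-1.
have Dq1 : 1 <= D * q by rewrite -[1]mulr1 ler_pM.
have t0 : 0 < t by rewrite invr_gt0; nra.
have t2 : t <= 2^-1 by rewrite lef_pV2 ?posrE //; nra.
exists (1 - t), (217 * d%:R); split; first lra.
split; first lra.
move=> p c tp p1 c1 U L j s _ N3 _ mu stat.
set N := #|{: Et s}| in N3 *.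
have N4 : (4 <= N)%N.
  by rewrite -(ler_nat R); apply: le_trans N3; rewrite ler_nat (leq_trans _ (leq_pexp2l _ _ : 3 ^ 2 <= _)%N) //; lia.
have Nr4 : 4 <= N%:R :> R by rewrite (ler_nat R 4).
have lN := ln_ge1 Nr4.
set l := ln N%:R in lN *.
have cl1 : 1 <= c * l by rewrite -[1]mulr1 ler_pM.
set r := 217 * d%:R * c ^+ 2 * l ^+ 2.
have rE : r = 217 * d%:R * (c * l) ^+ 2 by rewrite /r; ring.
have cl2 : 1 <= (c * l) ^+ 2.
  by rewrite expr2 mulr_ege1.
case: (eqVneq p 1) => [pE|pn1].
  subst p; rewrite (full_density_bad i01 _ stat); first by rewrite invr_ge0 powR_ge0.
    exact: leq_trans N4.
  by rewrite rE; nra.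
have {p1} p1 : p < 1 by rewrite lt_neqAle pn1.
have p0 : 0 < p by lra.
have odds_le : oddsc p <= 2 * t.
  rewrite /oddsc ler_pdivrMr //.
  have : t * 1 <= t * (2 * p) by apply: ler_wpM2l; [exact: ltW|lra].
  lra.
have small : 64 * D * eps p q <= 1.
  apply: (@le_trans _ _ (64 * D * (2 * t * q))).
    apply: ler_wpM2l; first by rewrite mulr_ge0 // (le_trans ler01).
    by rewrite ler_wpM2r // (le_trans ler01).
  have -> : 64 * D * (2 * t * q) = (128 * D * q) * t by ring.
  by rewrite /t divff // gt_eqF // -invr_gt0.
have Npos : (0 < N)%N by exact: leq_trans N4.
(* The factor 2 makes up for [ln 2 >= 1 / 2] in [N ^ c <= 2 ^ m]; as [c * l >= 1], rounding up keeps
   [m <= 3 * (c * l)]. *)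
pose m := (Num.truncn (2 * (c * l))).+1.
have cl0 : 0 <= 2 * (c * l) by lra.
have /andP [mlo mhi] := truncn_itv cl0.
have m2 : (2 <= m)%N by rewrite /m ltnS truncn_gt0; lra.
have mle : 2 * (c * l) <= m%:R by exact: ltW.
have mup : m%:R <= 3 * (c * l) by rewrite /m -natr1; lra.
have Nc : N%:R `^ c <= 2 ^+ m by apply: powR_le_pow2 => //; lra.
have N2 : N%:R <= 2 ^+ m :> R.
  apply: le_trans Nc; rewrite -[leLHS]powRr1 ?ler0n //.
  by apply: ler_powR => //; lra.
(* Of the decay [2 ^ - n] with [n = 2 * m], one half pays for the union over [N <= 2 ^ m] edges. *)
apply: le_trans (prob_bad_bound (n := (2 * m)%N) p0 p1 q1 Npos stat i01 small _) _.
  (* For [n = 2 * m] the radius is [d * (8 * m ^ 2 + 12 * m + 4)]. *)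
  apply: (@le_lt_trans _ _ (d * (24 * m ^ 2))%:R); last first.
    by rewrite rE (natrM _ d) (natrM _ 24) natrX; apply: radius_lt => //; rewrite ler0n.
  rewrite ler_nat leq_mul2l; apply/orP; right.
  by move: m2; clear; rewrite !expnS !expn0; nia.
apply: le_trans (error_sum_le m2 Npos N2) _.
by rewrite lef_pV2 ?posrE ?exprn_gt0 // powR_gt0 // ltr0n.
Qed.
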